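(* Let $X$ be a locally compact Polish space and $G$ be a group of homeomorphisms of $X$ (no topology on $G$ is assumed) such that $(\operatorname{card}(G),\operatorname{card}(X)) \neq (1,2)$. The following conditions are equivalent: (i) there exists $d \in \operatorname{Metr}_c(X)$ such that $\operatorname{Iso}(X,d) = G$; (ii) there exists a $G$-invariant metric in $\operatorname{Metr}_c(X)$, and for any $G$-invariant metric $d \in \operatorname{Metr}_c(X)$ and each $\varepsilon > 0$ there is $\varrho \in \operatorname{Metr}_c(X)$ such that $d \leq \varrho \leq (1+\varepsilon) d$ and $\operatorname{Iso}(X,\varrho) = G$; (iii) each of the following three conditions is fulfilled: (Iso1) $G$ is closed in the space $\mathcal{C}(X,X)$; (Iso2) for every compact set $K$ in $X$ the family $\mathcal{D}_K = \{h \in G : h(K) \cap K \neq \varnothing\}$ is evenly continuous and pointwise precompact; (Iso3) $\mathsf{H}_2(G) = G$.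
   Context: A space is Polish if it is separable and completely metrizable. A metric is proper if all closed balls with respect to it are compact. $\operatorname{Metr}_c(X)$ is the set of all proper metrics on $X$ inducing the topology of $X$. $\operatorname{Iso}(X,d)$ is the group of all bijective isometries of $(X,d)$. A metric $d$ on $X$ is $G$-invariant if $d(g(x),g(y)) = d(x,y)$ for all $g \in G$, $x,y \in X$. $\mathcal{C}(X,X)$ is the space of all continuous functions $X \to X$ with the compact-open topology. A collection $\mathcal{F}$ of functions from a topological space $X$ to a topological space $Y$ is evenly continuous if for any $x \in X$, $y \in Y$ and a neighbourhood $W$ of $y$ there exist neighbourhoods $U$ of $x$ and $V$ of $y$ such that the conditions $f \in \mathcal{F}$ and $f(x) \in V$ imply $f(U) \subset W$. $\mathcal{F}$ is pointwise precompact if for each $x \in X$ the closure in $Y$ of $\{f(x) : f \in \mathcal{F}\}$ is compact. For a collection $\mathcal{F}$ of functions from a set $X$ to a set $Y$, the symmetrized 2-hull $\mathsf{H}_2(\mathcal{F})$ is the family of all functions $g\colon X \to Y$ such that for any two (not necessarily distinct) points $x,y \in X$ there is $f \in \mathcal{F}$ with $\{g(x),g(y)\} = \{f(x),f(y)\}$. *)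

(* Defs.v *)
From HB Require Import structures.
From mathcomp Require Import all_boot all_order all_algebra.
From mathcomp Require Import all_classical all_reals all_analysis.

Set Implicit Arguments.
Unset Strict Implicit.
Unset Printing Implicit Defensive.

Import Order.TTheory GRing.Theory Num.Theory.
Import numFieldNormedType.Exports.

Local Open Scope classical_set_scope.
Local Open Scope ring_scope.

(* Several metrics live on one topological space, so metrics are plain functions
   [X -> X -> R] rather than [metricType] structures on [X]. *)
Section Metrics.
Context {R : realType} {X : topologicalType}.
Implicit Types d : X -> X -> R.

Record is_metric d : Prop := IsMetric {
  dist_ge0 : forall x y, 0 <= d x y ;
  dist_eq0 : forall x y, d x y = 0 <-> x = y ;
  dist_sym : forall x y, d x y = d y x ;
  dist_triangle : forall x y z, d x z <= d x y + d y z }.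

Definition open_dball d (x : X) (r : R) : set X := [set y | d x y < r].

Definition closed_dball d (x : X) (r : R) : set X := [set y | d x y <= r].

Definition induces_topology d : Prop :=
  forall x : X, nbhs x = nbhs_ball_ (open_dball d) x.

Definition cauchy_seq d (u : nat -> X) : Prop :=
  forall e : R, 0 < e ->
    exists N : nat, forall m n : nat,
      (N <= m)%N -> (N <= n)%N -> d (u m) (u n) < e.

(* Convergence is that of the ambient topology of [X]; this is used only for
   metrics inducing it. *)
Definition complete_metric d : Prop :=
  forall u : nat -> X, cauchy_seq d u -> exists x : X, u n @[n --> \oo] --> x.

Definition proper_metric d : Prop :=
  forall (x : X) (r : R), compact (closed_dball d x r).

Definition Metr_c : set (X -> X -> R) :=
  [set d | [/\ is_metric d, induces_topology d & proper_metric d]].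

Definition Iso d : set (X -> X) :=
  [set f | bijective f /\ forall x y, d (f x) (f y) = d x y].

Definition invariant_metric (G : set (X -> X)) d : Prop :=
  forall g, G g -> forall x y, d (g x) (g y) = d x y.

End Metrics.

Definition separable (X : topologicalType) : Prop :=
  exists2 D : set X, countable D & dense D.

Definition completely_metrizable (R : realType) (X : topologicalType) : Prop :=
  exists d : X -> X -> R,
    [/\ is_metric d, induces_topology d & complete_metric d].

Definition polish_space (R : realType) (X : topologicalType) : Prop :=
  separable X /\ completely_metrizable R X.

Definition homeomorphism {X : topologicalType} (f : X -> X) : Prop :=
  continuous f /\
  exists g : X -> X, [/\ continuous g, cancel f g & cancel g f].

Record homeomorphism_group {X : topologicalType} (G : set (X -> X)) : Prop :=
  HomeomorphismGroup {
    group_homeo : forall f, G f -> homeomorphism f ;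
    group_id : G idfun ;
    group_comp : forall f g, G f -> G g -> G (f \o g) ;
    group_inv : forall f, G f ->
      exists g, [/\ G g, cancel f g & cancel g f] }.

(* The space C(X, Y): continuous maps, with the subspace topology inherited from
   the compact-open topology on all maps. *)
Definition continuous_maps (X Y : topologicalType) :=
  initial_topology
    (fun f : continuousType X Y => (f : X -> Y) : {compact-open, X -> Y}).

Definition closed_in_continuous_maps {X : topologicalType}
    (G : set (X -> X)) : Prop :=
  closed ([set f : continuousType X X | G f] : set (continuous_maps X X)).

Definition evenly_continuous {X Y : topologicalType} (F : set (X -> Y)) : Prop :=
  forall (x : X) (y : Y) (W : set Y), nbhs y W ->
    exists U V, [/\ nbhs x U, nbhs y V &
      forall f, F f -> V (f x) -> f @` U `<=` W].

(* [pointwise_precompact] requires a uniform structure on the codomain. *)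
Definition pointwise_precompact_family {X Y : topologicalType}
    (F : set (X -> Y)) : Prop :=
  forall x : X, compact (closure [set f x | f in F]).

Definition meeting_family {X : Type} (G : set (X -> X)) (K : set X) :
    set (X -> X) :=
  [set h | G h /\ (h @` K) `&` K !=set0].

(* [x] and [y] may coincide, so [g x] is always a value [f x] with [f] in [F]. *)
Definition symmetrized_2hull {X Y : Type} (F : set (X -> Y)) : set (X -> Y) :=
  [set g | forall x y : X,
    exists2 f, F f & [set g x; g y] = [set f x; f y]].

(* Main.v *)
Require Import Defs.
From HB Require Import structures.
From mathcomp Require Import all_boot all_order all_algebra.
From mathcomp Require Import all_classical all_reals all_analysis.
From mathcomp Require Import lra.
Import Order.TTheory GRing.Theory Num.Theory.
Import numFieldNormedType.Exports.
Local Open Scope classical_set_scope.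
Local Open Scope ring_scope.

(** Why the theorem holds.

    Necessity of (iii). Isometries are equicontinuous, and those isometries that
    make a compact set [K] meet its image move any given point by a bounded
    amount, so properness gives (Iso2). A limit of surjective isometries is
    surjective because the preimages of a point stay in one compact ball. A
    member of the hull of [Iso d] preserves distances; after composition with an isometry it
    fixes a point, hence maps every ball around that point into itself, and a
    distance-preserving self-map of a compact space is onto
    ([dist_preserving_surj]).

    An invariant proper metric from (Iso2). Let [w > 0] be a weight vanishing at
    infinity. The distance [min (d0 x y) (w x + w y)] comes from a metric of the
    one-point compactification of [X]. Its supremum [delta] over [G] is still
    continuous: translates of two near points that leave a large compact set
    are close anyway, and the remaining translations form an equicontinuous
    family ([orbit_equicontinuous]). Properness is obtained by pricing steps:
    going from [x] to [y] costs [delta x y] divided by the supremum over [g] of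
    [min (w (g x)) (w (g y))], and the distance is that of the cheapest chain.
    An affordable step from a given compact set has both ends translated by a
    single [g] into a fixed compact set, so (Iso2) confines it ([jump_reach]).
    A cheap chain of many tiny steps is confined too, because the divisor is
    small where only small [delta]-balls are relatively compact
    ([cheap_chain_short]).

    Perturbing an invariant proper metric. Let [D x y] be the distance from the
    unordered pair [{x, y}] to the orbit of [{p, q}], measured by an invariant
    metric [rho]. Since [max (c - D) rho] is 1-Lipschitz in each variable, its
    minimum with [(1 + a) rho] is again an invariant metric
    ([min_dilation_metric]); for [c] slightly above [rho p q] it has a peak of
    height [c] along the orbit of [{p, q}]. Such peaks can be raised one after
    another by ever smaller factors, and the increasing limit
    ([stably_dense_all], a category argument) is a metric [sigma] for which
    - the local maxima of [sigma] are dense among the pairs of distinct points,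
    - the positive maxima of [sigma] over two compact boxes of pairs whose
      orbits keep a positive distance from each other are different.
    A bijection preserving [sigma] carries local maxima to local maxima of the
    same height, so it cannot send one to a pair at positive distance from its
    [G]-orbit. By density every pair of distinct points is moved approximately
    as by elements of [G], and exactly so by the compactness argument
    [orbit_limit], which is where (Iso1) enters. The exclusion of a trivial
    group on two points extends this to pairs of equal points
    ([offdiagonal_2hull]), and (Iso3) then places the bijection in [G]. *)

Set Implicit Arguments.
Unset Strict Implicit.
Unset Printing Implicit Defensive.

(** * Suprema of families and metrics as functions *)

Lemma inv_nat_lt (R : realType) (e : R) : 0 < e -> exists n, n.+1%:R^-1 < e.
Proof.
move=> e0; exists (Num.bound e^-1); rewrite invf_plt ?posrE ?ltr0n//.
apply: lt_trans (archi_boundP _) _; first by rewrite invr_ge0 ltW.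
by rewrite ltr_nat.
Qed.

Section FamilySupInf.
Context {R : realType} {I : Type}.
Implicit Types (A : set I) (f : I -> R).

Definition isup A f : R := sup [set f i | i in A].
Definition iinf A f : R := inf [set f i | i in A].

Lemma isup_ge {A f} M i : (forall j, A j -> f j <= M) -> A i -> f i <= isup A f.
Proof.
move=> fM Ai; apply: ub_le_sup; last by exists i.
by exists M => _ [j Aj <-]; exact: fM.
Qed.

Lemma isup_le {A f M} :
  A !=set0 -> (forall i, A i -> f i <= M) -> isup A f <= M.
Proof.
move=> [i Ai] fM; apply: ge_sup; first by exists (f i), i.
by move=> _ [j Aj <-]; exact: fM.
Qed.

Lemma isup_gt {A f x} :
  A !=set0 -> x < isup A f -> exists2 i, A i & x < f i.
Proof.
move=> [i Ai] /sup_gt[|_ [j Aj <-] xj]; first by exists (f i), i.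
by exists j.
Qed.

Lemma iinf_le {A f} m i : (forall j, A j -> m <= f j) -> A i -> iinf A f <= f i.
Proof.
move=> fm Ai; apply: ge_inf; last by exists i.
by exists m => _ [j Aj <-]; exact: fm.
Qed.

Lemma iinf_ge {A f m} :
  A !=set0 -> (forall i, A i -> m <= f i) -> m <= iinf A f.
Proof.
move=> [i Ai] fm; apply: lb_le_inf; first by exists (f i), i.
by move=> _ [j Aj <-]; exact: fm.
Qed.

Lemma iinf_lt {A f x} :
  A !=set0 -> iinf A f < x -> exists2 i, A i & f i < x.
Proof.
move=> [i Ai] /inf_lt[|_ [j Aj <-] xj]; first by exists (f i), i.
by exists j.
Qed.

End FamilySupInf.

Section MetricFacts.
Context {R : realType} {X : topologicalType}.
Variable d : X -> X -> R.
Hypothesis dM : is_metric d.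

Lemma dist_refl x : d x x = 0.
Proof. by rewrite (dist_eq0 dM). Qed.

Lemma dist_gt0 x y : x <> y -> 0 < d x y.
Proof.
move=> xy; rewrite lt_neqAle (dist_ge0 dM) andbT eq_sym.
by apply/eqP => /(dist_eq0 dM).
Qed.

Lemma dist_small_eq x y : (forall e, 0 < e -> d x y < e) -> x = y.
Proof.
move=> xy; apply/(dist_eq0 dM)/eqP; rewrite eq_le (dist_ge0 dM) andbT.
by apply/ler_addgt0Pl => e /xy /ltW; rewrite addr0.
Qed.

Hypothesis dT : induces_topology d.

Lemma nbhs_distP x (A : set X) :
  nbhs x A <-> exists2 e, 0 < e & forall y, d x y < e -> A y.
Proof. by rewrite dT. Qed.

Lemma near_dist x e : 0 < e -> nbhs x [set y | d x y < e].
Proof. by move=> e0; apply/nbhs_distP; exists e. Qed.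

Lemma induced_hausdorff : hausdorff_space X.
Proof.
move=> p q pq; apply: dist_small_eq => e e0.
have e20 : 0 < e / 2 by rewrite divr_gt0.
have [z [/= pz qz]] := pq _ _ (near_dist p e20) (near_dist q e20).
have := dist_triangle dM p z q; rewrite (dist_sym dM z q); lra.
Qed.

Lemma continuous_dist (Y : topologicalType) (f : Y -> X) :
  (forall y e, 0 < e -> \forall z \near y, d (f y) (f z) < e) -> continuous f.
Proof.
by move=> fc y A /nbhs_distP[e e0 eA]; apply: filterS (fc _ _ e0) => z /eA.
Qed.

Lemma lip_closed_le (f : X -> R) r :
  (forall x y, f x <= f y + d x y) -> closed [set x | f x <= r].
Proof.
move=> fL p pcl; rewrite /= leNgt; apply/negP => rp.
have [|y [/= yr py]] := pcl _ (near_dist p (e := f p - r) _).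
  by rewrite subr_gt0.
have := fL p y; lra.
Qed.

Lemma lip_closed_ge (f : X -> R) r :
  (forall x y, f x <= f y + d x y) -> closed [set x | r <= f x].
Proof.
move=> fL p pcl; rewrite /= leNgt; apply/negP => rp.
have [|y [/= yr py]] := pcl _ (near_dist p (e := r - f p) _).
  by rewrite subr_gt0.
have := fL y p; rewrite (dist_sym dM) in py; lra.
Qed.

Lemma closed_dball_closed x r : closed (closed_dball d x r).
Proof.
by apply: lip_closed_le => y z; rewrite (dist_sym dM y) (dist_triangle dM).
Qed.

Lemma isometry_continuous (f : X -> X) :
  (forall x y, d (f x) (f y) = d x y) -> continuous f.
Proof.
move=> fd; apply: continuous_dist => y e e0; apply: filterS (near_dist y e0).
by move=> z /=; rewrite fd.
Qed.

End MetricFacts.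

(** * The compact-open topology *)

Section CompactOpen.
Context {X : topologicalType}.
Variable G : set (X -> X).

(** Closedness in [continuous_maps] speaks of bundled continuous functions; this
    lemma and the next one translate it to plain functions, once for limits of
    filters and once for single open sets. *)
Lemma closed_maps_cvg (F : set_system (X -> X)) (h : X -> X) :
  ProperFilter F -> closed_in_continuous_maps G ->
  (forall g, G g -> continuous g) -> F G -> continuous h ->
  {compact-open, F --> h} -> G h.
Proof.
move=> FF Gcl Gc FG hc Fh.
pose hC : continuousType X X := HB.pack h (isContinuous.Build X X h hc).
suff : [set f : continuousType X X | G f] hC by [].
apply: Gcl => B [C [[V oV <-] /= Vh VB]].
have FV : F V by apply: Fh; apply: open_nbhs_nbhs; split.
have [g [Gg Vg]] := filter_ex (filterI FG FV).
pose gC : continuousType X X := HB.pack g (isContinuous.Build X X g (Gc g Gg)).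
by exists gC; split => //; exact: VB.
Qed.

Lemma closure_maps_meet (f : continuousType X X)
    (O : set {compact-open, X -> X}) :
  closure ([set f : continuousType X X | G f] : set (continuous_maps X X)) f ->
  open O -> O f -> exists2 g, G g & O g.
Proof.
move=> fcl oO Of.
have [|g [Gg Og]] := fcl [set g : continuousType X X | O (g : X -> X)].
  exists [set g : continuousType X X | O (g : X -> X)]; split => //.
  by exists O.
by exists g.
Qed.

End CompactOpen.

(** * Isometry groups of proper metrics *)

Lemma inj_surj_bijective (S T : Type) (f : S -> T) :
  injective f -> (forall y, exists x, f x = y) -> bijective f.
Proof.
move=> finj /choice[g gK]; exists g => x; last exact: gK.
by apply: finj; rewrite gK.
Qed.

Lemma set2_eq (T : Type) (a b c e : T) :
  [set a; b] = [set c; e] -> (a = c /\ b = e) \/ (a = e /\ b = c).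
Proof.
move=> E.
have : [set c; e] a by rewrite -E; left.
have : [set c; e] b by rewrite -E; right.
have : [set a; b] c by rewrite E; left.
have : [set a; b] e by rewrite E; right.
by rewrite /=; case=> h1; case=> h2; case=> h3; case=> h4; subst; tauto.
Qed.

Section IsometryGroup.
Context {R : realType} {X : topologicalType}.
Variable d : X -> X -> R.
Hypothesis dC : Metr_c d.

Let dM : is_metric d. Proof. by have [] := dC. Qed.
Let dT : induces_topology d. Proof. by have [] := dC. Qed.
Let dP : proper_metric d. Proof. by have [] := dC. Qed.

Lemma dist_preserving_inj (f : X -> X) :
  (forall x y, d (f x) (f y) = d x y) -> injective f.
Proof.
by move=> fd x y fxy; apply/(dist_eq0 dM); rewrite -fd fxy (dist_refl dM).
Qed.

(** The iterates of [y] stay in a compact ball around [p], so two of them are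
    close; since [f] preserves distances, a later iterate comes close to [y]
    itself. Thus [y] is in the closure of the image of the ball, which is
    compact. *)
Lemma dist_preserving_surj (f : X -> X) p :
  (forall x y, d (f x) (f y) = d x y) -> f p = p ->
  forall y, exists x, f x = y.
Proof.
move=> fd fp y; pose B := closed_dball d p (d p y).
have fnd n x z : d (iter n f x) (iter n f z) = d x z.
  by elim: n => //= n IHn; rewrite fd.
have fnp n : iter n f p = p by elim: n => //= n ->.
have Bfn n : B (iter n f y) by rewrite /B /closed_dball /= -{1}(fnp n) fnd.
have fBcl : closed (f @` B).
  apply: compact_closed; first exact: (induced_hausdorff dM dT).
  apply: continuous_compact; last exact: dP.
  by apply: continuous_subspaceT; exact: (isometry_continuous dT).
suff /fBcl[x _ <-] : closure (f @` B) y by exists x.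
move=> A /(nbhs_distP dT)[e e0 eA].
have [|z [_ zF]] := @dP p (d p y) ((iter n f y) @[n --> \oo]) _.
  change (\forall n \near \oo, B (iter n f y)).
  exact: nearW.
have zy N : exists2 n, (N <= n)%N & d z (iter n f y) < e / 2.
  pose tail := [set iter n f y | n in [set n | (N <= n)%N]].
  have [|_ [[n /= Nn <-] zn]] :=
      zF tail _ _ (near_dist dT z (divr_gt0 e0 (ltr0n _ 2))).
    change (\forall n \near \oo, tail (iter n f y)).
    by apply: filterS (nbhs_infty_ge N) => n Nn; exists n.
  by exists n.
have [m _ zm] := zy 0%N; have [n mn zn] := zy m.+1.
exists (iter (n - m) f y); split.
  rewrite -(prednK (n := (n - m)%N)) ?subn_gt0//.
  by exists (iter (n - m).-1 f y).
apply: eA; rewrite -(fnd m) -iterD subnKC 1?ltnW//.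
have := dist_triangle dM (iter m f y) z (iter n f y).
by move: zm zn; rewrite /= (dist_sym dM z (iter m f y)); lra.
Qed.

(** Evaluation at points shows that a limit [f] preserves distances. If [y] were
    not a value of [f], then [f] would send the compact ball [K] below into the
    complement of [y], and so would some isometry [g] close to [f] at [y]; but
    the preimage of [y] under such a [g] lies in [K]. *)
Lemma Iso_closed : closed_in_continuous_maps (Iso d).
Proof.
move=> f fcl.
have approx x y e : 0 < e ->
    exists g, [/\ Iso d g, d (f x) (g x) < e & d (f y) (g y) < e].
  move=> e0.
  pose V z : set {compact-open, X -> X} :=
    [set g | g @` [set z] `<=` ((open_dball d (f z) e)^°)%classic].
  have Vo z : open (V z).
    by apply: compact_open_open; [exact: compact_set1|exact: open_interior].
  have Vf z : V z f.
    by move=> _ [_ -> <-]; apply: (near_dist dT).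
  have Vd z g : V z g -> d (f z) (g z) < e.
    move=> /(_ (g z)) gz; apply: (interior_subset (A := open_dball d (f z) e)).
    by apply: gz; exists z.
  have [g Gg [Vx Vy]] :=
    closure_maps_meet fcl (openI (Vo x) (Vo y)) (conj (Vf x) (Vf y)).
  by exists g; split => //; exact: Vd.
have fd x y : d (f x) (f y) = d x y.
  apply/eqP; rewrite eq_le; apply/andP; split; apply/ler_addgt0Pl => e e0;
    have e20 : 0 < e / 2 by rewrite divr_gt0.
  - have [g [[_ gd] gx gy]] := approx x y _ e20.
    have := dist_triangle dM (f x) (g x) (f y).
    have := dist_triangle dM (g x) (g y) (f y).
    rewrite gd (dist_sym dM (g y)); lra.
  - have [g [[_ gd] gx gy]] := approx x y _ e20.
    have := dist_triangle dM (g x) (f x) (g y).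
    have := dist_triangle dM (f x) (f y) (g y).
    rewrite gd (dist_sym dM (g x)); lra.
split=> //; apply: inj_surj_bijective; first exact: dist_preserving_inj.
move=> y; apply: contrapT => /forallNP nfy.
pose K := closed_dball d y (d y (f y) + 1).
pose V1 : set {compact-open, X -> X} := [set g | g @` K `<=` [set~ y]].
pose V2 : set {compact-open, X -> X} :=
    [set g | g @` [set y] `<=` ((open_dball d (f y) 1)^°)%classic].
have oV1 : open V1.
  apply: compact_open_open; first exact: dP.
  apply: closed_openC; apply: compact_closed; last exact: compact_set1.
  exact: (induced_hausdorff dM dT).
have oV2 : open V2.
  by apply: compact_open_open; [exact: compact_set1|exact: open_interior].
have V1f : V1 f by move=> _ [x Kx <-] /=; exact: nfy.
have V2f : V2 f by move=> _ [_ -> <-]; apply: (near_dist dT).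
have [g [gb gd] [V1g V2g]] :=
  closure_maps_meet fcl (openI oV1 oV2) (conj V1f V2f).
case: gb => g' gK g'K.
apply: (V1g y) => //; exists (g' y) => //.
rewrite /K /closed_dball /= -gd g'K (dist_sym dM).
have : d (f y) (g y) < 1.
  by apply: (interior_subset (A := open_dball d (f y) 1)); apply: V2g; exists y.
have := dist_triangle dM y (f y) (g y); lra.
Qed.

Lemma Iso_evenly_continuous (F : set (X -> X)) :
  F `<=` Iso d -> evenly_continuous F.
Proof.
move=> FI x y W /(nbhs_distP dT)[e e0 eW].
have e20 : 0 < e / 2 by rewrite divr_gt0.
exists [set z | d x z < e / 2], [set z | d y z < e / 2].
split; [exact: (near_dist dT)..|].
move=> f /FI[_ fd] /= yfx _ [z /= xz <-]; apply: eW.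
have := dist_triangle dM y (f x) (f z); rewrite fd; lra.
Qed.

Lemma Iso_pointwise_precompact (K : set X) : compact K ->
  pointwise_precompact_family (meeting_family (Iso d) K).
Proof.
move=> Kc x.
have [[k0 Kk0]|K0] := pselect (K !=set0); last first.
  rewrite (_ : [set f x | f in _] = set0) ?closure0; first exact: compact0.
  by rewrite -subset0 => y [f [_ [z [_ Kz]]] _]; apply: K0; exists z.
have [M KM] : exists M, K `<=` closed_dball d k0 M.
  have /compact_near_coveringP/(_ R (pinfty_nbhs R)
    (fun M z => d k0 z <= M)) := Kc.
  case=> [z _|M [Mr HM]].
    exists ([set y | d z y < 1], [set M | d k0 z + 1 <= M]).
      split; first exact: (near_dist dT).
      by exists (d k0 z + 1); split; [exact: num_real|move=> r /= /ltW].
    move=> [y r] [/= zy kr]; have := dist_triangle dM k0 z y; lra.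
  by exists (M + 1) => y Ky; apply: HM Ky; rewrite ltrDl.
apply: subclosed_compact (@dP k0 (M + (M + d k0 x))) _.
  exact: closed_closure.
have dcl := closed_dball_closed dM dT (x := k0) (r := M + (M + d k0 x)).
move=> z zcl; apply: dcl; apply: closureS zcl.
move=> _ [f [[fb fd] [k [[u Ku fuk] Kk]]] <-].
rewrite /closed_dball /=.
have := dist_triangle dM k0 k (f x); rewrite -{2}fuk fd.
have := dist_triangle dM u k0 x; rewrite (dist_sym dM u k0).
have := KM _ Ku; have := KM _ Kk; rewrite /closed_dball /=; lra.
Qed.

(** A pair of equal points shows that a member [g] of the hull agrees at [y]
    with an isometry [f]; then the inverse of [f] composed with [g] fixes [y],
    so [dist_preserving_surj] applies to it. *)
Lemma Iso_symmetrized_2hull : symmetrized_2hull (Iso d) = Iso d.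
Proof.
apply/seteqP; split=> [g gH|f If x y]; last by exists f.
have gd x y : d (g x) (g y) = d x y.
  have [f [_ fd] E] := gH x y.
  by case: (set2_eq E) => -[-> ->]; rewrite fd // (dist_sym dM).
split=> //; apply: inj_surj_bijective; first exact: dist_preserving_inj.
move=> y; have [f [[f' fK f'K] fd] E] := gH y y.
have gfy : g y = f y by case: (set2_eq E) => -[].
have f'd u v : d (f' u) (f' v) = d u v by rewrite -fd !f'K.
have [||x f'gx] := @dist_preserving_surj (f' \o g) y _ _ (f' y).
- by move=> u v /=; rewrite f'd.
- by rewrite /= gfy fK.
- by exists x; rewrite -[RHS]f'K -f'gx /= f'K.
Qed.

End IsometryGroup.

(** * Limits in orbits *)

Section OrbitLimits.
Context {R : realType} {X : topologicalType}.
Variables (d : X -> X -> R) (G : set (X -> X)).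
Hypothesis dC : Metr_c d.
Hypothesis dG : invariant_metric G d.

Let dM : is_metric d. Proof. by have [] := dC. Qed.
Let dT : induces_topology d. Proof. by have [] := dC. Qed.
Let dP : proper_metric d. Proof. by have [] := dC. Qed.

Lemma ultra_cvg_dist (T : Type) (U : set_system T) (u : T -> X) (K : set X) :
  UltraFilter U -> compact K -> U [set t | K (u t)] ->
  exists p, forall e, 0 < e -> U [set t | d p (u t) < e].
Proof.
move=> UU Kc UK.
have [p [_ pU]] := Kc (u @ U) _ UK.
exists p => e e0.
have [//|UC] := in_ultra_setVsetC [set t | d p (u t) < e] UU.
by have [y [/= ye /ye]] := pU (~` [set y | d p y < e]) _ UC (near_dist dT p e0).
Qed.

(** Members of [G] are equicontinuous, so an open condition on their value at a
    point persists on a neighbourhood of the point chosen independently of the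
    map; finitely many such neighbourhoods cover a compact set. *)
Lemma pointwise_cvg_compact_open (F : set_system (X -> X)) (h : X -> X) :
  Filter F -> F G -> (forall z e, 0 < e -> F [set f | d (h z) (f z) < e]) ->
  {compact-open, F --> h}.
Proof.
move=> FF FG Fh; apply/compact_open_cvgP => K V Kc Vo hKV.
have /compact_near_coveringP/(_ _ F (fun f z => V (f z))) := Kc.
have cover z : K z -> \forall z' \near z & f \near F, V (f z').
  move=> Kz; have : nbhs (h z) V.
    by apply: open_nbhs_nbhs; split=> //; apply: hKV; exists z.
  move=> /(nbhs_distP dT)[e e0 eV].
  have e20 : 0 < e / 2 by rewrite divr_gt0.
  exists ([set y | d z y < e / 2], [set f | G f /\ d (h z) (f z) < e / 2]).
    split; first exact: (near_dist dT).
    by apply: filterI => //; exact: Fh.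
  move=> [y f] [/= zy [Gf zf]]; apply: eV.
  have := dist_triangle dM (h z) (f z) (f y); rewrite dG//; lra.
move=> /(_ _ cover) H; apply: filterS H => f fKV _ [z Kz <-]; exact: fKV.
Qed.

(** An Arzela-Ascoli argument: along an ultrafilter refining the approximations,
    the values at each point stay in a compact ball and hence converge, and the
    pointwise limit is a limit in the compact-open topology. *)
Lemma orbit_limit x y x' y' :
  homeomorphism_group G -> closed_in_continuous_maps G ->
  (forall e, 0 < e -> exists f, [/\ G f, d x' (f x) < e & d y' (f y) < e]) ->
  exists f, [/\ G f, f x = x' & f y = y'].
Proof.
move=> Ggrp Gcl approx.
pose B e : set (X -> X) := [set f | [/\ G f, d x' (f x) < e & d y' (f y) < e]].
pose F : set_system (X -> X) := filter_from [set e | 0 < e] B.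
have FF : ProperFilter F.
  apply: filter_from_proper; last by move=> e /= /approx.
  apply: filter_from_filter; first by exists 1 => /=.
  move=> a b /= a0 b0; exists (Num.min a b); first by rewrite /= lt_min a0.
  by move=> f [Gf]; rewrite !lt_min => /andP[? ?] /andP[? ?].
have [U [UU FU]] := ultraFilterLemma FF.
have UB e : 0 < e -> U (B e) by move=> e0; apply: FU; exists e.
have UG : U G by apply: filterS (UB _ ltr01) => f [].
have /choice[h hU] z : exists p, forall e, 0 < e -> U [set f | d p (f z) < e].
  apply: (@ultra_cvg_dist _ U (fun f => f z)
    (closed_dball d x' (1 + d x z))) => //.
  apply: filterS (UB _ ltr01) => f [Gf fx _] /=; rewrite /closed_dball /=.
  have := dist_triangle dM x' (f x) (f z); rewrite dG//; lra.
have UP : ProperFilter U by exact: ultra_proper.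
have hd u v : d (h u) (h v) = d u v.
  apply/eqP; rewrite eq_le; apply/andP; split; apply/ler_addgt0Pl => e e0;
    have e20 : 0 < e / 2 by rewrite divr_gt0.
  - have [f [Gf [/= hu hv]]] :=
      filter_ex (filterI UG (filterI (hU u _ e20) (hU v _ e20))).
    have := dist_triangle dM (h u) (f u) (h v).
    have := dist_triangle dM (f u) (f v) (h v).
    rewrite dG// (dist_sym dM (f v)); lra.
  - have [f [Gf [/= hu hv]]] :=
      filter_ex (filterI UG (filterI (hU u _ e20) (hU v _ e20))).
    have := dist_triangle dM (f u) (h u) (f v).
    have := dist_triangle dM (h u) (h v) (f v).
    rewrite (dist_sym dM (f u) (h u)) (dG Gf u v); lra.
exists h; split.
- apply: (@closed_maps_cvg _ G U) => //.
  + by move=> g /(group_homeo Ggrp)[].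
  + exact: (isometry_continuous dT).
  + exact: pointwise_cvg_compact_open.
- apply: (dist_small_eq dM) => e e0; have e20 : 0 < e / 2 by rewrite divr_gt0.
  have [f [[_ fx fy] /= hx]] := filter_ex (filterI (UB _ e20) (hU x _ e20)).
  have := dist_triangle dM (h x) (f x) x'.
  rewrite (dist_sym dM (f x) x'); lra.
- apply: (dist_small_eq dM) => e e0; have e20 : 0 < e / 2 by rewrite divr_gt0.
  have [f [[_ fx fy] /= hy]] := filter_ex (filterI (UB _ e20) (hU y _ e20)).
  have := dist_triangle dM (h y) (f y) y'.
  rewrite (dist_sym dM (f y) y'); lra.
Qed.

End OrbitLimits.

(** * A weight vanishing at infinity *)

Section DenseSequence.
Context {R : realType} {X : topologicalType}.
Variable d : X -> X -> R.
Hypothesis dM : is_metric d.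
Hypothesis dT : induces_topology d.

Lemma dense_sequence (x0 : X) : separable X ->
  exists s : nat -> X, forall x r, 0 < r -> exists n, d x (s n) < r.
Proof.
move=> [D /countable_injP[f finj] Dd].
exists (fun n => xget x0 [set z | D z /\ f z = n]) => x r r0.
have [|z [zr Dz]] := Dd (open_dball d x r)^° _ (@open_interior _ _).
  by exists x; exact: (near_dist dT).
exists (f z); case: xgetP => [y _ [Dy fyz]|/(_ z)[]//].
rewrite (finj _ _ _ _ fyz) ?inE//.
exact: (interior_subset zr).
Qed.

(** Countably many compact closed balls have interiors that cover the space.
    The weight is the supremum of tent functions on them, the [n]-th one being
    cut at height [1 / (n + 1)]: a point of weight at least [e] lies in one of
    the finitely many balls that allow this height. *)
Lemma vanishing_weight (x0 : X) :
  separable X -> locally_compact [set: X] ->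
  exists w : X -> R, [/\ forall x, 0 < w x <= 1,
    forall x y, w x <= w y + d x y &
    forall e, 0 < e -> compact [set x | e <= w x]].
Proof.
move=> /(dense_sequence x0)[s sD] Xlc.
(* An index encodes a center and a radius. A ball that is not compact gets
   radius 0, so that its tent function vanishes. *)
pose idx n : nat * nat := odflt (0, 0)%N (unpickle n).
pose ctr n := s (idx n).1.
pose good n := `[< compact (closed_dball d (ctr n) ((idx n).2.+1%:R^-1)) >].
pose rad n : R := if good n then (idx n).2.+1%:R^-1 else 0.
pose phi n x : R := Num.min n.+1%:R^-1 (Num.max 0 (rad n - d x (ctr n))).
have phi1 n x : phi n x <= 1.
  by rewrite ge_min invf_le1 ?ltr0n// ler1n.
pose w x := isup [set: nat] (phi^~ x).
have T0 : [set: nat] !=set0 by exists 0%N.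
have wge n x : phi n x <= w x by exact: (isup_ge (f := phi^~ x) (M := 1)).
have wL x y : w x <= w y + d x y.
  apply: isup_le => // n _.
  apply: le_trans (_ : phi n y + d x y <= _); last by rewrite lerD2r wge.
  have := dist_triangle dM y x (ctr n); rewrite (dist_sym dM y x).
  have := dist_ge0 dM x y; rewrite /phi; move: (n.+1%:R^-1) => a.
  rewrite !minElt !maxElt; do ! case: ifP; lra.
exists w; split=> //.
- move=> x; apply/andP; split; last exact: isup_le.
  have [U xU [Uc _]] := Xlc x Logic.I.
  have /(nbhs_distP dT)[e e0 eU] : nbhs x U.
    by apply: filterS (xU : nbhs x [set y | [set: X] y -> U y]) => y; exact.
  have e20 : 0 < e / 2 by rewrite divr_gt0.
  have [k ke] := inv_nat_lt e20.
  have k0 : 0 < k.+1%:R^-1 :> R by rewrite invr_gt0 ltr0n.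
  have [i xi] := sD x _ k0.
  pose n := pickle (i, k).
  have En : idx n = (i, k) by rewrite /idx pickleK.
  have gn : good n.
    apply/asboolP; rewrite /ctr En /=.
    apply: subclosed_compact (@closed_dball_closed _ _ _ dM dT _ _) Uc _ => y.
    rewrite /closed_dball /= => iy; apply: eU.
    have := lt_trans xi ke; have := le_lt_trans iy ke.
    have := dist_triangle dM x (s i) y; lra.
  apply: lt_le_trans (wge n x).
  rewrite /phi /rad gn /ctr En /= lt_min invr_gt0 ltr0n /= lt_max.
  by rewrite subr_gt0 xi orbT.
- move=> e e0.
  pose C n :=
    if good n then closed_dball d (ctr n) ((idx n).2.+1%:R^-1) else set0.
  have Cc n : compact (C n).
    by rewrite /C; case: ifP => [/asboolP//|_]; exact: compact0.
  pose N := Num.bound (2 / e).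
  apply: (@subclosed_compact _ _ (\big[setU/set0]_(n < N) C n)).
  + exact: (lip_closed_ge dM dT).
  + by apply: bigsetU_compact.
  + move=> x /= ex.
    have [|n _ nx] := isup_gt T0 (_ : e / 2 < w x).
      by apply: lt_le_trans ex; rewrite ltr_pdivrMr// mulr_natr mulr2n ltrDl.
    have e20 : 0 < e / 2 by rewrite divr_gt0.
    move: nx; rewrite lt_min => /andP[ne xn].
    have nN : (n < N)%N.
      rewrite -(ltr_nat R) -/N; apply: lt_trans (archi_boundP _); last first.
        by rewrite divr_ge0// ltW.
      apply: lt_trans (_ : n.+1%:R < _); first by rewrite ltr_nat.
      by rewrite -[2 / e]invf_div invf_pgt ?posrE ?ltr0n.
    rewrite -bigcup_mkord; exists n => //=.
    move: xn; rewrite lt_max ltNge (ltW e20) /= /rad /C.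
    case: ifP => _; last first.
      by have := dist_ge0 dM x (ctr n); lra.
    rewrite /closed_dball /= (dist_sym dM (ctr n)).
    by move: ((idx n).2.+1%:R^-1) => a; lra.
Qed.

End DenseSequence.

(** * Distances of cheapest chains *)

Section ChainMetric.
Context {R : realType} {X : topologicalType}.
Variables (c : X -> X -> R).

Fixpoint chain_cost x (s : seq X) : R :=
  if s is y :: s' then c x y + chain_cost y s' else 0.

Lemma chain_cost_cat x s t :
  chain_cost x (s ++ t) = chain_cost x s + chain_cost (last x s) t.
Proof. by elim: s x => [|y s IHs] x /=; rewrite ?add0r// IHs addrA. Qed.

Definition chain_dist x y : R :=
  iinf [set s | last x s = y] (chain_cost x).

Variable delta : X -> X -> R.
Hypothesis deltaM : is_metric delta.
Hypothesis c_ge : forall x y, delta x y <= c x y.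
Hypothesis c_sym : forall x y, c x y = c y x.

Lemma chain_cost_ge x s : delta x (last x s) <= chain_cost x s.
Proof.
elim: s x => [|y s IHs] x /=; first by rewrite (dist_refl deltaM).
apply: le_trans (dist_triangle deltaM _ y _) _; exact: lerD.
Qed.

Lemma chain_cost_ge0 x s : 0 <= chain_cost x s.
Proof. exact: le_trans (dist_ge0 deltaM _ _) (chain_cost_ge x s). Qed.

Lemma chain_cost_rev x s :
  exists2 t, last (last x s) t = x & chain_cost (last x s) t = chain_cost x s.
Proof.
elim: s x => [|y s IHs] x /=; first by exists [::].
have [t tl tc] := IHs y.
exists (t ++ [:: x]); first by rewrite last_cat.
by rewrite chain_cost_cat tl tc /= addr0 addrC c_sym.
Qed.

Lemma chain_dist_le_cost x s : chain_dist x (last x s) <= chain_cost x s.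
Proof. by apply: (iinf_le (m := 0)) => // t _; exact: chain_cost_ge0. Qed.

Lemma chain_dist_le x y : chain_dist x y <= c x y.
Proof. by have := chain_dist_le_cost x [:: y]; rewrite /= addr0. Qed.

Lemma chain_dist_lt x y r : chain_dist x y < r ->
  exists2 s, last x s = y & chain_cost x s < r.
Proof. by apply: iinf_lt; exists [:: y]. Qed.

Lemma chain_dist_ge x y : delta x y <= chain_dist x y.
Proof.
by apply: iinf_ge => [|s <-]; [exists [:: y]|exact: chain_cost_ge].
Qed.

(** Distinct points stay at positive distance because no chain beats [delta]. *)
Lemma chain_dist_metric : is_metric chain_dist.
Proof.
split.
- by move=> x y; apply: le_trans (chain_dist_ge x y); exact: dist_ge0.
- move=> x y; split=> [xy|<-].
    apply/(dist_eq0 deltaM)/eqP; rewrite eq_le (dist_ge0 deltaM) andbT -xy.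
    exact: chain_dist_ge.
  apply/eqP; rewrite eq_le; apply/andP; split.
    exact: (chain_dist_le_cost x [::]).
  by apply: le_trans (chain_dist_ge x x); exact: dist_ge0.
- suff le x y : chain_dist y x <= chain_dist x y.
    by move=> x y; apply/eqP; rewrite eq_le !le.
  apply: iinf_ge => [|s <-]; first by exists [:: y].
  have [t tl tc] := chain_cost_rev x s.
  by have := chain_dist_le_cost (last x s) t; rewrite tl tc.
- move=> x y z; apply/ler_addgt0Pl => e e0.
  have e20 : 0 < e / 2 by rewrite divr_gt0.
  have [|s sy sc] :=
      chain_dist_lt (_ : chain_dist x y < chain_dist x y + e / 2).
    by rewrite ltrDl.
  have [|t tz tc] :=
      chain_dist_lt (_ : chain_dist y z < chain_dist y z + e / 2).
    by rewrite ltrDl.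
  have := chain_dist_le_cost x (s ++ t).
  rewrite chain_cost_cat last_cat sy tz; lra.
Qed.

Lemma chain_dist_invariant (G : set (X -> X)) :
  (forall g, G g -> exists g', [/\ G g', cancel g g' & cancel g' g]) ->
  invariant_metric G c -> invariant_metric G chain_dist.
Proof.
move=> Ginv cG.
have cost g x s : G g -> chain_cost (g x) (map g s) = chain_cost x s.
  by move=> Gg; elim: s x => //= y s IHs x; rewrite cG// IHs.
have le g x y : G g -> chain_dist (g x) (g y) <= chain_dist x y.
  move=> Gg; apply: iinf_ge => [|s <-]; first by exists [:: y].
  by rewrite -(cost g)// -last_map chain_dist_le_cost.
move=> g Gg x y; apply/eqP; rewrite eq_le le//=.
have [g' [Gg' gK _]] := Ginv g Gg.
by have := le g' (g x) (g y) Gg'; rewrite !gK.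
Qed.

End ChainMetric.

(** * Proper actions have continuous orbit metrics *)

(** Right translation permutes [G]; this makes suprema and infima over [G]
    invariant. *)
Lemma image_translate (X : topologicalType) (T : Type) (G : set (X -> X)) h
    (P : (X -> X) -> T) :
  homeomorphism_group G -> G h ->
  [set P (g \o h) | g in G] = [set P g | g in G].
Proof.
move=> Ggrp Gh; have [h' [Gh' hK _]] := group_inv Ggrp Gh.
apply/seteqP; split=> [_ [g Gg <-]|_ [g Gg <-]].
  by exists (g \o h) => //; exact: (group_comp Ggrp).
exists (g \o h'); first exact: (group_comp Ggrp).
by congr P; apply/funext => x /=; rewrite hK.
Qed.

Lemma compact_uniform_threshold (R : realType) (X : topologicalType)
    (K : set X) (P : R -> X -> Prop) :
  compact K ->
  (forall s t x, 0 < s -> s <= t -> P t x -> P s x) ->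
  (forall x, K x -> exists2 t, 0 < t & \forall y \near x, P t y) ->
  exists2 t, 0 < t & forall x, K x -> P t x.
Proof.
move=> Kc Pmono Ploc.
have /compact_near_coveringP/(_ R (0^'+) (fun t x => P t x)) := Kc.
case=> [x /Ploc[t t0 Pt]|t t0 H].
  exists ([set y | P t y], [set s | 0 < s <= t]).
    split => //=; exists t => //= s /=.
    rewrite sub0r normrN => /ltW st s0.
    by rewrite s0 (le_trans _ st)// ler_norm.
  by move=> [y s] [/= Pty /andP[s0 st]]; exact: Pmono Pty.
have t20 : 0 < t / 2 by rewrite divr_gt0.
exists (t / 2) => // x Kx; apply: H => //=.
rewrite sub0r normrN gtr0_norm//; lra.
Qed.

Section InvariantMetric.
Context {R : realType} {X : topologicalType}.
Variables (d0 : X -> X -> R) (w : X -> R) (G : set (X -> X)).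
Hypothesis d0M : is_metric d0.
Hypothesis d0T : induces_topology d0.
Hypothesis w01 : forall x, 0 < w x <= 1.
Hypothesis w_lip : forall x y, w x <= w y + d0 x y.
Hypothesis w_compact : forall e, 0 < e -> compact [set x | e <= w x].
Hypothesis Ggrp : homeomorphism_group G.
Hypothesis Gproper : forall K : set X, compact K ->
  evenly_continuous (meeting_family G K) /\
  pointwise_precompact_family (meeting_family G K).

Let w_gt0 x : 0 < w x. Proof. by have /andP[] := w01 x. Qed.
Let w_le1 x : w x <= 1. Proof. by have /andP[] := w01 x. Qed.
Let G0 : G !=set0. Proof. by exists idfun; exact: group_id. Qed.

(** The metric of the one-point compactification in which [w x] is the distance
    from [x] to the point at infinity. *)
Definition vanishing_dist x y : R := Num.min (d0 x y) (w x + w y).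
Local Notation dv := vanishing_dist.

Let dvP x y : dv x y = d0 x y /\ d0 x y <= w x + w y \/
              dv x y = w x + w y /\ w x + w y <= d0 x y.
Proof. by rewrite /dv; case: leP; [left|right; split => //; exact: ltW]. Qed.

Lemma vanishing_dist_le x y : dv x y <= d0 x y.
Proof. by rewrite ge_min lexx. Qed.

Lemma vanishing_dist_metric : is_metric dv.
Proof.
split.
- by move=> x y; rewrite le_min (dist_ge0 d0M) addr_ge0// ltW.
- move=> x y; split=> [|->].
    case: (dvP x y) => -[-> _]; first by move/(dist_eq0 d0M).
    by move=> w0; exfalso; have := w_gt0 x; have := w_gt0 y; lra.
  by rewrite /dv (dist_refl d0M) min_l// addr_ge0// ltW.
- by move=> x y; rewrite /dv (dist_sym d0M) addrC.
- move=> x y z.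
  have := w_lip x y; have := w_lip z y; have := dist_triangle d0M x y z.
  rewrite (dist_sym d0M z y); have := w_gt0 y.
  by case: (dvP x y) => -[-> ?]; case: (dvP y z) => -[-> ?];
    case: (dvP x z) => -[-> ?]; lra.
Qed.

Lemma weight_lip_vanishing x y : w x <= w y + dv x y.
Proof.
have := w_lip x y; have := w_gt0 x; have := w_gt0 y.
by case: (dvP x y) => -[-> ?]; lra.
Qed.

Lemma compact_weight_ge (K : set X) : compact K ->
  exists2 e, 0 < e & forall x, K x -> e <= w x.
Proof.
move=> Kc; apply: (compact_uniform_threshold (P := fun e x => e <= w x)) Kc _ _.
  by move=> s t x _ st; exact: le_trans.
move=> x _; have wx20 : 0 < w x / 2 by rewrite divr_gt0.
exists (w x / 2) => //; apply: filterS (near_dist d0T x wx20) => y /= xy.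
have := w_lip x y; lra.
Qed.

(** Even continuity controls [f y] only while [f x] is near a prescribed point;
    precompactness of the set of the values [f x] leaves finitely many such
    points to consider. *)
Lemma meeting_family_equicontinuous (L : set X) x e : compact L -> 0 < e ->
  \forall y \near x, forall f, meeting_family G L f -> d0 (f x) (f y) < e.
Proof.
move=> Lc e0; have [Lev Lpre] := Gproper Lc.
have e20 : 0 < e / 2 by rewrite divr_gt0.
have /compact_near_coveringP/(_ X (nbhs x) (fun y z =>
    forall f, meeting_family G L f -> f x = z -> d0 (f x) (f y) < e)) := Lpre x.
have cover z : closure [set f x | f in meeting_family G L] z ->
    \forall z' \near z & y \near x, forall f,
      meeting_family G L f -> f x = z' -> d0 (f x) (f y) < e.
  move=> _; have [U [V [xU zV UV]]] := Lev x z _ (near_dist d0T z e20).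
  exists (V, U) => //= -[z' y] [/= Vz' Uy] f Lf fx.
  have fV : V (f x) by rewrite fx.
  have /= zx := UV f Lf fV _ (ex_intro2 _ _ x (nbhs_singleton xU) erefl).
  have /= zy := UV f Lf fV _ (ex_intro2 _ _ y Uy erefl).
  have := dist_triangle d0M (f x) z (f y); rewrite (dist_sym d0M (f x) z); lra.
move=> /(_ _ cover) H; apply: filterS H => y H f Lf.
by apply: (H (f x)) => //; apply: subset_closure; exists f.
Qed.

(** If [g x] and [g y] both have weight below [a] they are close to each other
    at infinity. Otherwise [g] maps a point of the compact set [L] into [L], and
    such maps form an equicontinuous family. *)
Lemma orbit_equicontinuous x e : 0 < e ->
  \forall y \near x, forall g, G g -> dv (g x) (g y) < e.
Proof.
move=> e0; have e20 : 0 < e / 2 by rewrite divr_gt0.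
pose a := Num.min (e / 2) (w x / 2).
have a0 : 0 < a by rewrite lt_min !divr_gt0.
pose L : set X := [set z | a <= w z].
have xL y : d0 x y < a -> L y.
  have := w_lip x y; have := w_gt0 x.
  have : a <= w x / 2 by rewrite /a ge_min lexx orbT.
  by rewrite /L /=; lra.
have := meeting_family_equicontinuous x (w_compact a0) e0.
apply: filterS2 (near_dist d0T x a0) => y /= xy H g Gg.
have Lx : L x by apply: xL; rewrite (dist_refl d0M).
have ae : a <= e / 2 by rewrite ge_min lexx.
have [Lgx|nLgx] := lerP a (w (g x)).
  apply: le_lt_trans (vanishing_dist_le _ _) (H g _).
  by split=> //; exists (g x); split => //; exists x.
have [Lgy|nLgy] := lerP a (w (g y)).
  apply: le_lt_trans (vanishing_dist_le _ _) (H g _).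
  by split=> //; exists (g y); split => //; exists y => //; exact: xL.
rewrite gt_min; apply/orP; right; lra.
Qed.

(** The form of (Iso2) that is used for properness, compactness being measured
    by lower bounds of [w]. The inverse of [g] maps [g x] back to [x], hence is
    one of the maps that make a superlevel set of [w] meet its image, and it
    carries [g y], a point of that set, to [y]. *)
Lemma weight_reach e : 0 < e -> exists2 e', 0 < e' &
  forall x y g, G g -> e <= w x -> e <= w (g x) -> e <= w (g y) -> e' <= w y.
Proof.
move=> e0; pose L : set X := [set x | e <= w x].
have Lc : compact L by exact: w_compact.
have [t t0 tL] : exists2 t, 0 < t & forall u, L u ->
    forall h, meeting_family G L h -> t <= w (h u).
  apply: (compact_uniform_threshold (P := fun t u =>
    forall h, meeting_family G L h -> t <= w (h u))) => //.
    by move=> s t x _ st H h /H; exact: le_trans.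
  move=> u _; have [_ Lpre] := Gproper Lc.
  have [t t0 tu] := compact_weight_ge (Lpre u).
  have t20 : 0 < t / 2 by rewrite divr_gt0.
  exists (t / 2) => //; apply: filterS (orbit_equicontinuous u t20) => y H h Lh.
  have := H h Lh.1; have := weight_lip_vanishing (h u) (h y).
  have : t <= w (h u) by apply: tu; apply: subset_closure; exists h.
  lra.
exists t => // x y g Gg ex egx egy.
have [h [Gh gK _]] := group_inv Ggrp Gg.
rewrite -(gK y); apply: tL => //.
by split=> //; exists x; split => //; exists (g x).
Qed.

Definition orbit_dist x y : R := isup G (fun g => dv (g x) (g y)).
Local Notation delta := orbit_dist.

Let dv_le2 x y : dv x y <= 2.
Proof.
have := w_le1 x; have := w_le1 y.
by case: (dvP x y) => -[-> ?]; lra.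
Qed.

Lemma orbit_dist_ge g x y : G g -> dv (g x) (g y) <= delta x y.
Proof.
by move=> Gg; apply: (isup_ge (M := 2) (f := fun g => dv (g x) (g y))).
Qed.

Lemma orbit_dist_invariant : invariant_metric G delta.
Proof.
move=> h Gh x y; rewrite /orbit_dist /isup.
by rewrite -[in RHS](image_translate (fun g => dv (g x) (g y)) Ggrp Gh).
Qed.

Lemma orbit_dist_metric : is_metric delta.
Proof.
have dvM := vanishing_dist_metric.
have ge x y : dv x y <= delta x y := orbit_dist_ge x y (group_id Ggrp).
split.
- by move=> x y; apply: le_trans (ge x y); exact: dist_ge0.
- move=> x y; split=> [xy|->].
    apply/(dist_eq0 dvM)/eqP; rewrite eq_le (dist_ge0 dvM) andbT -xy.
    exact: ge.
  apply/eqP; rewrite eq_le; apply/andP; split.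
    by apply: isup_le => // g _; rewrite (dist_refl dvM).
  by apply: le_trans (ge y y); exact: dist_ge0.
- move=> x y; congr isup; apply/funext => g; exact: dist_sym.
- move=> x y z; apply: isup_le => // g Gg.
  apply: le_trans (dist_triangle dvM _ (g y) _) _.
  by apply: lerD; exact: orbit_dist_ge.
Qed.

Lemma orbit_dist_near x e : 0 < e -> \forall y \near x, delta x y < e.
Proof.
move=> e0; have e20 : 0 < e / 2 by rewrite divr_gt0.
apply: filterS (orbit_equicontinuous x e20) => y H.
apply: (@le_lt_trans _ _ (e / 2)); last lra.
by apply: isup_le => // g /H /ltW.
Qed.

Lemma orbit_dist_small x e : 0 < e -> exists2 r, 0 < r &
  forall y, delta x y < r -> d0 x y < e.
Proof.
move=> e0; exists (Num.min e (w x)); first by rewrite lt_min e0 w_gt0.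
move=> y; rewrite lt_min => /andP[ye yw].
have := orbit_dist_ge x y (group_id Ggrp); have := w_gt0 y.
by case: (dvP x y) => -[/= -> ?]; lra.
Qed.

End InvariantMetric.

(** * An invariant proper metric *)

Lemma induces_topologyP (R : realType) (X : topologicalType)
    (d : X -> X -> R) :
  (forall x e, 0 < e -> \forall y \near x, d x y < e) ->
  (forall x (A : set X), nbhs x A ->
    exists2 e, 0 < e & forall y, d x y < e -> A y) ->
  induces_topology d.
Proof.
move=> dnear dsmall x; apply/seteqP; split=> [A /dsmall[e e0 eA]|A [e e0 eA]].
  by exists e.
by apply: filterS (dnear x e e0).
Qed.

Section ProperMetric.
Context {R : realType} {X : topologicalType}.
Variables (delta : X -> X -> R) (w : X -> R) (G : set (X -> X)).
Hypothesis deltaM : is_metric delta.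
Hypothesis deltaT : induces_topology delta.
Hypothesis deltaG : invariant_metric G delta.
Hypothesis w01 : forall x, 0 < w x <= 1.
Hypothesis w_lip : forall g x y, G g -> w (g x) <= w (g y) + delta x y.
Hypothesis w_compact : forall e, 0 < e -> compact [set x | e <= w x].
Hypothesis w_reach : forall e, 0 < e -> exists2 e', 0 < e' &
  forall x y g, G g -> e <= w x -> e <= w (g x) -> e <= w (g y) -> e' <= w y.
Hypothesis Ggrp : homeomorphism_group G.

Let w_gt0 x : 0 < w x. Proof. by have /andP[] := w01 x. Qed.
Let w_le1 x : w x <= 1. Proof. by have /andP[] := w01 x. Qed.
Let G1 : G idfun. Proof. exact: group_id. Qed.
Let G0 : G !=set0. Proof. by exists idfun. Qed.

(** Large when a single element of [G] moves both points to where [w] is large.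
    The [delta]-ball around [x] with radius a quarter of the value at [(x, x)]
    is relatively compact, see [short_step_reach]. *)
Definition joint_weight x y : R :=
  isup G (fun g => Num.min (w (g x)) (w (g y))).
Local Notation m := joint_weight.
Local Notation rho x := (m x x).

Let min_le1 x y : Num.min (w x) (w y) <= 1.
Proof. by rewrite ge_min w_le1. Qed.

Lemma joint_weight_ge g x y : G g -> Num.min (w (g x)) (w (g y)) <= m x y.
Proof.
move=> Gg; apply: (isup_ge (M := 1)
  (f := fun g => Num.min (w (g x)) (w (g y)))) => //.
Qed.

Lemma joint_weight_gt0 x y : 0 < m x y.
Proof.
by apply: lt_le_trans (joint_weight_ge x y G1); rewrite lt_min !w_gt0.
Qed.

Lemma joint_weight_le1 x y : m x y <= 1.
Proof. exact: isup_le. Qed.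

Lemma joint_weight_sym x y : m x y = m y x.
Proof. by congr isup; apply/funext => g; rewrite minC. Qed.

Lemma joint_weight_le_self x y : m x y <= rho x.
Proof.
apply: isup_le => // g Gg; apply: le_trans (joint_weight_ge x x Gg).
by rewrite minxx ge_min lexx.
Qed.

Lemma self_weight_ge x : w x <= rho x.
Proof. by have := joint_weight_ge x x G1; rewrite minxx. Qed.

Lemma self_weight_lip x y : rho x <= rho y + delta x y.
Proof.
apply: isup_le => // g Gg; rewrite minxx; apply: le_trans (w_lip x y Gg) _.
by rewrite lerD2r; have := joint_weight_ge y y Gg; rewrite minxx.
Qed.

Lemma joint_weight_invariant : invariant_metric G m.
Proof.
move=> h Gh x y; rewrite /joint_weight /isup.
pose f g := Num.min (w (g x)) (w (g y)).
by rewrite -[in RHS](image_translate f Ggrp Gh).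
Qed.

(** As in a quasi-hyperbolic metric, steps become expensive where only small
    balls are relatively compact; they are also expensive between points that no
    element of [G] brings back together. *)
Definition jump_cost x y : R := delta x y / m x y.
Local Notation c := jump_cost.

Lemma jump_costK x y : delta x y = c x y * m x y.
Proof. by rewrite /c divfK// gt_eqF// joint_weight_gt0. Qed.

Lemma jump_cost_ge0 x y : 0 <= c x y.
Proof. by rewrite divr_ge0 ?(dist_ge0 deltaM)// ltW// joint_weight_gt0. Qed.

Lemma jump_cost_ge x y : delta x y <= c x y.
Proof. by rewrite jump_costK ler_piMr ?jump_cost_ge0// joint_weight_le1. Qed.

Lemma jump_cost_sym x y : c x y = c y x.
Proof. by rewrite /c (dist_sym deltaM) joint_weight_sym. Qed.

Lemma jump_cost_invariant : invariant_metric G c.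
Proof. by move=> g Gg x y; rewrite /c deltaG// joint_weight_invariant. Qed.

Local Notation d := (chain_dist c).
Local Notation cost := (chain_cost c).

Let cost_ge0 x s : 0 <= cost x s.
Proof. exact: (chain_cost_ge0 deltaM jump_cost_ge). Qed.

(** A step multiplies [rho] by at most 1 plus its cost and has [delta]-length at
    most its cost times [rho]. On a chain of total cost at most [1 / 2] these
    factors do not accumulate beyond 2. *)
Lemma cheap_chain_short x s : cost x s <= 1 / 2 ->
  delta x (last x s) <= 2 * rho x * cost x s.
Proof.
elim: s x => [|y s IHs] x /=; first by rewrite (dist_refl deltaM) mulr0.
have cs0 := cost_ge0 y s; have cxy0 := jump_cost_ge0 x y.
move=> cs; have {IHs} := IHs y.
set C := cost y s in cs0 cs *; set a := c x y in cs cxy0 *.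
have dxy : delta x y <= a * rho x.
  by rewrite jump_costK ler_wpM2l// joint_weight_le_self.
have := dist_triangle deltaM x y (last y s).
have ryx : rho y <= rho x * (1 + a).
  by have := self_weight_lip y x; rewrite (dist_sym deltaM y x); lra.
have rx0 := joint_weight_gt0 x x.
move=> tri IH.
have {}IH : delta y (last y s) <= 2 * rho y * C by apply: IH; lra.
have h1 : rho y * C <= rho x * (1 + a) * C by rewrite ler_wpM2r.
have h2 : rho x * a * C <= rho x * a * (1 / 2).
  by apply: ler_wpM2l; [rewrite mulr_ge0// ltW|lra].
nra.
Qed.

(** An element of [G] that almost realises [rho x] at [x] also gives [y] a large
    weight, so that [w_reach] applies. *)
Lemma short_step_reach e : 0 < e -> exists2 e', 0 < e' &
  forall x y, e <= w x -> delta x y < rho x / 4 -> e' <= w y.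
Proof.
move=> e0; have e20 : 0 < e / 2 by rewrite divr_gt0.
have [e' e'0 H] := w_reach e20; exists e' => // x y ex xy.
have rx := self_weight_ge x.
have [|g Gg] := isup_gt G0 (_ : rho x * (3 / 4) < rho x).
  by have := joint_weight_gt0 x x; lra.
rewrite minxx => gx; have := w_lip x y Gg => gy.
by apply: (H x y g) => //; lra.
Qed.

(** Either the step is short, or [delta x y] is bounded below and the price
    bound forces the joint weight to be bounded below. *)
Lemma jump_reach e t : 0 < e -> 0 < t -> exists2 e', 0 < e' &
  forall x y, e <= w x -> c x y <= t -> e' <= w y.
Proof.
move=> e0 t0; have [a a0 Ha] := short_step_reach e0.
pose b := Num.min e (e / (8 * t)).
have b0 : 0 < b by rewrite lt_min e0 divr_gt0// mulr_gt0.
have [b' b'0 Hb] := w_reach b0.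
exists (Num.min a b'); first by rewrite lt_min a0.
move=> x y ex cxy; rewrite ge_min.
have [xy|xy] := ltP (delta x y) (rho x / 4); first by rewrite (Ha x y).
apply/orP; right.
have rx := self_weight_ge x.
have mxy : e / (8 * t) < m x y.
  rewrite ltr_pdivrMr ?mulr_gt0//; rewrite jump_costK in xy.
  have : c x y * m x y <= t * m x y.
    by rewrite ler_wpM2r// ltW// joint_weight_gt0.
  lra.
have [g Gg] := isup_gt G0 mxy; rewrite lt_min => /andP[gx gy].
apply: (Hb x y g) => //; rewrite /b ge_min ?ex//.
- by rewrite (ltW gx) orbT.
- by rewrite (ltW gy) orbT.
Qed.

(** Cut the chain where its partial cost first exceeds [a]: a single jump
    crosses this level, and the rest costs at most [k]. *)
Lemma chain_split x s a k : 0 <= a ->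
  cost x s <= a + k -> cost x s <= a \/ exists s1 y s2,
    [/\ cost x s1 <= a, c (last x s1) y <= a + k, cost y s2 <= k &
       last y s2 = last x s].
Proof.
move=> a0; suff H t u : cost x u <= a -> cost x (u ++ t) <= a + k ->
    cost x (u ++ t) <= a \/ exists s1 y s2,
    [/\ cost x s1 <= a, c (last x s1) y <= a + k, cost y s2 <= k &
       last y s2 = last x (u ++ t)].
  by apply: (H s [::]).
elim: t u => [|y t IHt] u ua; first by rewrite cats0; left.
have [uya|uya] := lerP (cost x (rcons u y)) a.
  by rewrite -cat_rcons; exact: IHt.
move=> uyt; right; exists u, y, t; split => //; last by rewrite last_cat.
- move: uyt; rewrite chain_cost_cat /=.
  by have := cost_ge0 x u; have := cost_ge0 y t; lra.
- move: uyt uya; rewrite -cats1 !chain_cost_cat /=; lra.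
Qed.

(** By induction on the cost in units of [1 / 16]. The part of a chain after the
    cut costs at most one unit, hence has [delta]-length at most an eighth of
    [rho] at its start, which is short in the sense of [short_step_reach]. *)
Lemma chain_reach x n : exists2 e, 0 < e &
  forall s, cost x s <= n%:R / 16 -> e <= w (last x s).
Proof.
elim: n => [|n [e e0 He]].
  exists (w x) => // s; rewrite mul0r => s0.
  have : delta x (last x s) <= 0.
    by apply: le_trans s0; exact: (chain_cost_ge deltaM jump_cost_ge).
  move=> xs; suff <- : x = last x s by [].
  by apply/(dist_eq0 deltaM)/eqP; rewrite eq_le xs (dist_ge0 deltaM).
have n0 : 0 <= n%:R / 16 :> R by rewrite divr_ge0.
have [|a a0 Ha] := jump_reach e0 (_ : 0 < n%:R / 16 + 16^-1).
  by rewrite ltr_wpDl ?invr_gt0.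
have [b b0 Hb] := short_step_reach a0.
exists (Num.min e b); first by rewrite lt_min e0.
move=> s; rewrite ge_min mulrSr mulrDl mul1r => /(chain_split n0)[/He->//|].
move=> [s1 [y [s2 [s1n jy ys2 <-]]]]; apply/orP; right.
apply: (Hb y); first exact: Ha (He _ s1n) jy.
have := @cheap_chain_short y s2; have := joint_weight_gt0 y y.
have := cost_ge0 y s2; set C := cost y s2 in ys2 *; set r := rho y.
move=> C0 r0 H.
have : delta y (last y s2) <= 2 * r * C by apply: H; lra.
have : r * C <= r * 16^-1 by rewrite ler_wpM2l// ltW.
lra.
Qed.

Lemma proper_invariant_metric :
  exists2 d : X -> X -> R, Metr_c d & invariant_metric G d.
Proof.
have dM := chain_dist_metric deltaM jump_cost_ge jump_cost_sym.
have dge := chain_dist_ge deltaM jump_cost_ge.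
have dT : induces_topology d.
  apply: induces_topologyP => [x e e0|x A]; last first.
    move=> /(nbhs_distP deltaT)[e e0 eA].
    by exists e => // y xy; apply: eA; exact: le_lt_trans (dge _ _) xy.
  pose a := Num.min (w x / 2) (e * (w x / 2)).
  have wx20 : 0 < w x / 2 by rewrite divr_gt0.
  have a0 : 0 < a by rewrite lt_min wx20 mulr_gt0.
  apply: filterS (near_dist deltaT x a0) => y /=.
  rewrite lt_min => /andP[xy xye].
  apply: le_lt_trans (chain_dist_le deltaM jump_cost_ge x y) _.
  rewrite /c ltr_pdivrMr ?joint_weight_gt0//.
  apply: (lt_le_trans xye); rewrite ler_pM2l//.
  apply: le_trans (joint_weight_ge x y G1); rewrite le_min /=.
  have := w_lip x y G1; rewrite /=; have := w_gt0 x => ? ?.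
  apply/andP; split; lra.
exists d; last first.
  exact: (chain_dist_invariant deltaM jump_cost_ge (group_inv Ggrp)
    jump_cost_invariant).
split=> // x r; pose n := Num.bound ((Num.max 0 r + 1) * 16).
have [e e0 He] := chain_reach x n.
apply: subclosed_compact (w_compact e0) _.
  exact: (closed_dball_closed dM dT).
move=> y; rewrite /closed_dball /= => xy.
have [|s <- xs] := chain_dist_lt (_ : d x y < n%:R / 16); last first.
  by apply: He; exact: ltW.
apply: (le_lt_trans xy); apply: (@lt_trans _ _ (Num.max 0 r + 1)).
  by rewrite (@le_lt_trans _ _ (Num.max 0 r))// ?le_max ?lexx ?orbT// ltrDl.
rewrite ltr_pdivlMr//; apply: archi_boundP.
by rewrite mulr_ge0// addr_ge0// le_max lexx.
Qed.

End ProperMetric.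

Lemma invariant_proper_metric_exists (R : realType) (X : topologicalType)
    (G : set (X -> X)) :
  polish_space R X -> locally_compact [set: X] -> homeomorphism_group G ->
  (forall K : set X, compact K ->
    evenly_continuous (meeting_family G K) /\
    pointwise_precompact_family (meeting_family G K)) ->
  exists2 d : X -> X -> R, Metr_c d & invariant_metric G d.
Proof.
move=> [Xsep [d0 [d0M d0T _]]] Xlc Ggrp Gproper.
have [[x0 _]|X0] := pselect ([set: X] !=set0); last first.
  have F (x : X) : False by apply: X0; exists x.
  by exists (fun _ _ => 0) => [|g _ x]; [split; [split| |] => x|]; case: (F x).
have [w [w01 wlip wc]] := vanishing_weight d0M d0T x0 Xsep Xlc.
have dnear := orbit_dist_near d0M d0T w01 wlip wc Ggrp Gproper.
have dsmall := orbit_dist_small d0 w01 Ggrp.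
apply: (@proper_invariant_metric _ _ (orbit_dist d0 w G) w) => //.
- exact: orbit_dist_metric.
- apply: induces_topologyP => // x A /(nbhs_distP d0T)[e e0 eA].
  have [r r0 H] := dsmall x e e0.
  by exists r => // y /H; exact: eA.
- exact: orbit_dist_invariant.
- move=> g x y Gg.
  apply: le_trans (weight_lip_vanishing w01 wlip (g x) (g y)) _.
  by rewrite lerD2l; exact: orbit_dist_ge.
- exact: (weight_reach d0M d0T).
Qed.

(** * Stretching invariant metrics *)

Section Stretching.
Context {R : realType} {X : topologicalType}.
Variable G : set (X -> X).
Hypothesis Ggrp : homeomorphism_group G.
Implicit Types rho sigma : X -> X -> R.

Let G1 : G idfun. Proof. exact: group_id. Qed.
Let G0 : G !=set0. Proof. by exists idfun. Qed.

Definition stretch rho (a : R) sigma :=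
  forall x y, rho x y <= sigma x y <= (1 + a) * rho x y.

(** If both terms on the right-hand side of the triangle inequality are
    dilations, it is the one of [rho] multiplied by [1 + a]. If one of them is a
    value of [mm], the other is at least a value of [rho], and the Lipschitz
    bound on [mm] applies. *)
Lemma min_dilation_metric rho (a : R) mm :
  is_metric rho -> 0 <= a -> (forall x y, mm x y = mm y x) ->
  (forall x y, rho x y <= mm x y) ->
  (forall x y z, mm x z <= mm x y + rho y z) ->
  is_metric (fun x y => Num.min ((1 + a) * rho x y) (mm x y)).
Proof.
move=> rM a0 msym mge mlip; set u := fun x y => _.
have rle x y : rho x y <= (1 + a) * rho x y.
  by rewrite ler_peMl ?(dist_ge0 rM)// lerDl.
have uge x y : rho x y <= u x y by rewrite le_min rle mge.
have usym x y : u x y = u y x by rewrite /u (dist_sym rM) msym.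
split=> //.
- by move=> x y; apply: le_trans (uge x y); exact: dist_ge0.
- move=> x y; split=> [xy|->].
    by apply/(dist_eq0 rM)/eqP; rewrite eq_le (dist_ge0 rM) andbT -xy.
  apply/eqP; rewrite eq_le; apply/andP; split.
    by rewrite /u (dist_refl rM) mulr0 ge_min lexx.
  by apply: le_trans (uge y y); exact: dist_ge0.
have um x y z : mm x y <= (1 + a) * rho x y -> u x z <= u x y + u y z.
  move=> mr; have -> : u x y = mm x y by rewrite /u min_r.
  apply: (@le_trans _ _ (mm x z)); first by rewrite ge_min lexx orbT.
  by apply: le_trans (mlip x y z) _; rewrite lerD2l.
move=> x y z; have [mxy|mxy] := leP (mm x y) ((1 + a) * rho x y).
  exact: um.
have [mzy|mzy] := leP (mm z y) ((1 + a) * rho z y).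
  by rewrite usym addrC (usym y z) (usym x y); exact: um.
have -> : u x y = (1 + a) * rho x y by rewrite /u min_l// ltW.
have -> : u y z = (1 + a) * rho y z.
  by rewrite usym /u min_l ?(dist_sym rM y)// ltW.
rewrite -mulrDr; apply: (@le_trans _ _ ((1 + a) * rho x z)).
  by rewrite ge_min lexx.
by rewrite ler_wpM2l ?addr_ge0// dist_triangle.
Qed.

Section Bump.
Variables (rho : X -> X -> R) (p q : X).
Hypothesis rM : is_metric rho.
Hypothesis rG : invariant_metric G rho.

(** The distance from the unordered pair [{x, y}] to the orbit of [{p, q}]. *)
Definition orbit_gap x y : R := iinf G (fun g =>
  Num.min (rho (g x) p + rho (g y) q) (rho (g x) q + rho (g y) p)).
Local Notation D := orbit_gap.

Let r0 x y : 0 <= rho x y. Proof. exact: dist_ge0. Qed.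

Lemma orbit_gap_le g x y : G g ->
  D x y <= rho (g x) p + rho (g y) q /\ D x y <= rho (g x) q + rho (g y) p.
Proof.
move=> Gg; pose f g :=
  Num.min (rho (g x) p + rho (g y) q) (rho (g x) q + rho (g y) p).
have : D x y <= f g.
  by apply: (iinf_le (m := 0) (f := f)) Gg => j _; rewrite le_min !addr_ge0.
by rewrite /f le_min => /andP[].
Qed.

Lemma orbit_gap_ge x y t :
  (forall g, G g -> t <= rho (g x) p + rho (g y) q /\
                    t <= rho (g x) q + rho (g y) p) -> t <= D x y.
Proof.
by move=> H; apply: iinf_ge => // g /H[? ?]; rewrite le_min; apply/andP.
Qed.

Lemma orbit_gap_lt x y t : D x y < t -> exists2 g, G g &
  rho (g x) p + rho (g y) q < t \/ rho (g x) q + rho (g y) p < t.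
Proof.
by move=> /(iinf_lt G0)[g Gg]; rewrite gt_min => /orP ?; exists g.
Qed.

Lemma orbit_gap_ge0 x y : 0 <= D x y.
Proof. by apply: orbit_gap_ge => g _; rewrite !addr_ge0. Qed.

Lemma orbit_gap_refl : D p q = 0.
Proof.
apply/eqP; rewrite eq_le orbit_gap_ge0 andbT.
by have [/= + _] := orbit_gap_le p q G1; rewrite !(dist_refl rM) addr0.
Qed.

Lemma orbit_gap_sym x y : D x y = D y x.
Proof.
congr iinf; apply/funext => g; rewrite minC.
by rewrite (addrC (rho (g x) q)) (addrC (rho (g x) p)).
Qed.

Lemma orbit_gap_lip x y z : D x y <= D x z + rho z y.
Proof.
rewrite -lerBlDr; apply: orbit_gap_ge => g Gg.
have [H1 H2] := orbit_gap_le x y Gg.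
have := dist_triangle rM (g y) (g z) p; have := dist_triangle rM (g y) (g z) q.
rewrite (dist_sym rM (g y) (g z)) (rG Gg z y); lra.
Qed.

Lemma orbit_gap_invariant : invariant_metric G D.
Proof.
move=> h Gh x y; rewrite /orbit_gap /iinf.
by rewrite -[in RHS](image_translate (fun g =>
  Num.min (rho (g x) p + rho (g y) q) (rho (g x) q + rho (g y) p)) Ggrp Gh).
Qed.

Lemma dist_le_orbit_gap x y : rho x y <= rho p q + D x y.
Proof.
rewrite -lerBlDl; apply: orbit_gap_ge => g Gg; rewrite -(rG Gg x y).
have := dist_triangle rM (g x) p (g y); have := dist_triangle rM p q (g y).
have := dist_triangle rM (g x) q (g y); have := dist_triangle rM q p (g y).
rewrite (dist_sym rM q p) (dist_sym rM q (g y)) (dist_sym rM p (g y)); lra.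
Qed.

Variables (a c : R).
Hypothesis a_ge0 : 0 <= a.

(** A cone of height [c] over the orbit of [{p, q}], kept between [rho] and its
    dilation. *)
Definition orbit_bump x y : R :=
  Num.min ((1 + a) * rho x y) (Num.max (c - D x y) (rho x y)).

Lemma bump_stretch : stretch rho a orbit_bump.
Proof.
move=> x y; rewrite ge_min lexx /= le_min le_max lexx orbT !andbT.
by rewrite ler_peMl ?r0// lerDl.
Qed.

Lemma bump_metric : is_metric orbit_bump.
Proof.
apply: min_dilation_metric => //.
- by move=> x y; rewrite orbit_gap_sym (dist_sym rM).
- by move=> x y; rewrite le_max lexx orbT.
- move=> x y z; rewrite ge_max; apply/andP; split.
    have := orbit_gap_lip x y z; rewrite (dist_sym rM z y) => H.
    apply: (@le_trans _ _ (c - D x y + rho y z)); first lra.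
    by rewrite lerD2r le_max lexx.
  apply: le_trans (dist_triangle rM x y z) _.
  by rewrite lerD2r le_max lexx orbT.
Qed.

Lemma bump_invariant : invariant_metric G orbit_bump.
Proof. by move=> g Gg x y; rewrite /orbit_bump orbit_gap_invariant// rG. Qed.

Lemma bump_center :
  rho p q <= c -> c <= (1 + a) * rho p q -> orbit_bump p q = c.
Proof.
by move=> rc cr; rewrite /orbit_bump orbit_gap_refl subr0 max_l// min_r.
Qed.

Lemma bump_le x y t : c - D x y <= t -> rho x y <= t -> orbit_bump x y <= t.
Proof. by move=> ct rt; rewrite ge_min ge_max ct rt orbT. Qed.

End Bump.

Variable d : X -> X -> R.
Hypothesis dM : is_metric d.

Definition comparable_metric sigma := [/\ is_metric sigma,
  invariant_metric G sigma & exists2 C, 0 < C &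
  forall x y, d x y <= sigma x y <= C * d x y].

Lemma stretch_comparable rho a sigma : comparable_metric rho -> 0 < a ->
  stretch rho a sigma -> is_metric sigma -> invariant_metric G sigma ->
  comparable_metric sigma.
Proof.
move=> [rM rG [C C0 rC]] a0 rs sM sG; split => //.
exists ((1 + a) * C); first by rewrite mulr_gt0// addr_gt0.
move=> x y; have /andP[dr rd] := rC x y; have /andP[sr sr'] := rs x y.
rewrite (le_trans dr sr) (le_trans sr')// -mulrA ler_wpM2l// addr_ge0// ltW//.
Qed.

Lemma bump_comparable rho p q a c : comparable_metric rho -> 0 < a ->
  comparable_metric (orbit_bump rho p q a c).
Proof.
move=> rho_c a0; have [rM rG _] := rho_c.
apply: (stretch_comparable rho_c a0).
- exact: bump_stretch (ltW a0).
- exact: bump_metric (ltW a0).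
- exact: bump_invariant.
Qed.

(** The analogue of containing a dense open set, in a space of metrics where
    perturbations only increase distances. *)
Definition stably_dense (P : (X -> X -> R) -> Prop) := forall rho a,
  comparable_metric rho -> 0 < a -> exists sigma b,
  [/\ comparable_metric sigma, 0 < b, stretch rho a sigma &
     forall tau, comparable_metric tau -> stretch sigma b tau -> P tau].

Lemma stretch_refl rho a : is_metric rho -> 0 <= a -> stretch rho a rho.
Proof. by move=> rM a0 x y; rewrite lexx ler_peMl ?(dist_ge0 rM)// lerDl. Qed.

Lemma stretch_trans rho a sigma b c tau : is_metric rho ->
  0 <= a -> 0 <= b -> (1 + a) * (1 + b) <= 1 + c ->
  stretch rho a sigma -> stretch sigma b tau -> stretch rho c tau.
Proof.
move=> rM a0 b0 abc rs st x y.
have /andP[r1 r2] := rs x y; have /andP[s1 s2] := st x y.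
rewrite (le_trans r1 s1) (le_trans s2)//=.
apply: (@le_trans _ _ ((1 + b) * ((1 + a) * rho x y))).
  by rewrite ler_wpM2l// addr_ge0.
by rewrite mulrA (mulrC (1 + b)) ler_wpM2r// dist_ge0.
Qed.

Lemma stretch_le rho a b sigma : is_metric rho -> a <= b ->
  stretch rho a sigma -> stretch rho b sigma.
Proof.
move=> rM ab rs x y; have /andP[-> h] /= := rs x y.
by apply: le_trans h _; rewrite ler_wpM2r ?(dist_ge0 rM)// lerD2l.
Qed.

(** A category argument. The conditions are met one at a time by stretching, and
    the stretches still admissible after each step form nested intervals. The
    increasing limit of the metrics belongs to all these intervals. *)
Lemma stably_dense_all (I : countType) (P : I -> (X -> X -> R) -> Prop) rho a :
  (forall i, stably_dense (P i)) -> comparable_metric rho -> 0 < a ->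
  exists sigma, [/\ comparable_metric sigma, stretch rho a sigma &
    forall i, P i sigma].
Proof.
move=> Pd rho_c a0.
pose Q k sigma := if unpickle k is Some i then P i sigma else True.
have step (ks : nat * ((X -> X -> R) * R)) : exists s' : (X -> X -> R) * R,
    comparable_metric ks.2.1 -> 0 < ks.2.2 ->
    [/\ comparable_metric s'.1, 0 < s'.2,
      forall tau, stretch s'.1 s'.2 tau -> stretch ks.2.1 ks.2.2 tau &
      forall tau, comparable_metric tau -> stretch s'.1 s'.2 tau -> Q ks.1 tau].
  case: ks => k [r b] /=.
  have [rb|nrb] := pselect (comparable_metric r /\ 0 < b); last first.
    by exists (r, b) => rc b0; case: nrb.
  have [rc b0] := rb; have [rM _ _] := rc.
  (* Chosen so that two stretches by [t] stay within a stretch by [b]. *)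
  pose t := Num.min 1 (b / 3).
  have t0 : 0 < t by rewrite lt_min ltr01 divr_gt0.
  have t1 : t <= 1 by rewrite ge_min lexx.
  have tb : t <= b / 3 by rewrite ge_min lexx orbT.
  have tt : (1 + t) * (1 + t) <= 1 + b by nra.
  have [s [e [sc e0 rs sQ]]] : exists sigma e,
      [/\ comparable_metric sigma, 0 < e, stretch r t sigma &
      forall tau, comparable_metric tau -> stretch sigma e tau -> Q k tau].
    rewrite /Q; case: (unpickle k) => [i|]; first exact: Pd.
    by exists r, 1; split => //; apply: stretch_refl => //; exact: ltW.
  have [sM _ _] := sc.
  exists (s, Num.min e t) => _ _ /=; split=> //.
  - by rewrite lt_min e0.
  - move=> tau st; apply: stretch_trans tt rs _ => //; try exact: ltW.
    by apply: stretch_le st => //; rewrite ge_min lexx orbT.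
  - move=> tau tc st; apply: sQ => //.
    by apply: stretch_le st => //; rewrite ge_min lexx.
have /choice[nxt nxtP] := step.
pose fix S n := if n is m.+1 then nxt (m, S m) else (rho, a).
have SP n : comparable_metric (S n).1 /\ 0 < (S n).2.
  by elim: n => [//|n [c b]] /=; have [] := nxtP (n, S n) c b.
have Smono n tau :
    stretch (S n.+1).1 (S n.+1).2 tau -> stretch (S n).1 (S n).2 tau.
  by have [c b] := SP n; have [_ _ H _] := nxtP (n, S n) c b; exact: H.
have Snest n m tau : (n <= m)%N ->
    stretch (S m).1 (S m).2 tau -> stretch (S n).1 (S n).2 tau.
  move=> /subnK <-; elim: (m - n)%N => [//|k IHk].
  by rewrite addSn => /Smono.
have SM n : is_metric (S n).1 by have [[]] := SP n.
have Sself n : stretch (S n).1 (S n).2 (S n).1.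
  by apply: stretch_refl => //; have [_ /ltW] := SP n.
have Sub n m x y : (S m).1 x y <= (1 + (S n).2) * (S n).1 x y.
  have [nm|/ltnW mn] := leqP n m.
    by have /andP[] := Snest n m _ nm (Sself m) x y.
  apply: (@le_trans _ _ ((S n).1 x y)).
    by have /andP[] := Snest m n _ mn (Sself n) x y.
  by have /andP[] := Sself n x y.
pose sigma x y := isup [set: nat] (fun n => (S n).1 x y).
have sge n x y : (S n).1 x y <= sigma x y.
  by apply: (isup_ge (f := fun n => (S n).1 x y)) => // j _; exact: (Sub 0%N).
have sS n : stretch (S n).1 (S n).2 sigma.
  move=> x y; rewrite sge /=; apply: isup_le => //; by exists 0%N.
have T0 : [set: nat] !=set0 by exists 0%N.
have sM : is_metric sigma.
  split.
  - by move=> x y; apply: le_trans (sge 0%N x y); exact: dist_ge0.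
  - move=> x y; split=> [xy|->].
      apply/(dist_eq0 (SM 0%N))/eqP.
      by rewrite eq_le (dist_ge0 (SM 0%N)) andbT -xy.
    apply/eqP; rewrite eq_le; apply/andP; split.
      by apply: isup_le => // n _; rewrite (dist_refl (SM n)).
    by apply: le_trans (sge 0%N y y); exact: dist_ge0.
  - by move=> x y; congr isup; apply/funext => n; exact: dist_sym.
  - move=> x y z; apply: isup_le => // n _.
    by apply: le_trans (dist_triangle (SM n) x y z) _; exact: lerD.
have sG : invariant_metric G sigma.
  move=> g Gg x y; congr isup; apply/funext => n.
  by have [[_ SG _] _] := SP n; rewrite SG.
have sc : comparable_metric sigma.
  exact: (stretch_comparable rho_c a0 (sS 0%N)).
exists sigma; split => //; first exact: (sS 0%N).
move=> i; have [c b] := SP (pickle i).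
have [_ _ _ H] := nxtP (pickle i, S (pickle i)) c b.
by move: (H sigma sc (sS (pickle i).+1)); rewrite /Q /= pickleK.
Qed.

End Stretching.

(** * Separating the maxima over two boxes *)

Section Generic.
Context {R : realType} {X : topologicalType}.
Variables (G : set (X -> X)) (d : X -> X -> R).
Hypothesis Ggrp : homeomorphism_group G.
Hypothesis dC : Metr_c d.
Hypothesis dG : invariant_metric G d.

Let dM : is_metric d. Proof. by have [] := dC. Qed.
Let dT : induces_topology d. Proof. by have [] := dC. Qed.
Let dP : proper_metric d. Proof. by have [] := dC. Qed.

Local Notation "s @@ u" := (s u.1 u.2) (at level 20).

Definition orbit_separated (A B : set (X * X)) := exists2 eta : R, 0 < eta &
  forall u v f, A u -> B v -> G f ->
    eta <= d (f u.1) v.1 + d (f u.2) v.2 /\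
    eta <= d (f u.1) v.2 + d (f u.2) v.1.

Definition max_at (A : set (X * X)) (sigma : X -> X -> R) u :=
  A u /\ forall v, A v -> sigma @@ v <= sigma @@ u.

(** The value 0 is excluded because no stretch changes it. *)
Definition maxima_differ A B (sigma : X -> X -> R) := forall u v,
  max_at A sigma u -> max_at B sigma v -> 0 < sigma @@ u ->
  sigma @@ u <> sigma @@ v.

Lemma stretch_keeps_lt (rho : X -> X -> R) (A : set (X * X)) v t :
  is_metric rho -> (forall u, A u -> rho @@ u <= t) -> 0 <= t -> t < rho @@ v ->
  exists2 b, 0 < b & forall tau, stretch rho b tau ->
    forall u, A u -> tau @@ u < tau @@ v.
Proof.
move=> rM At t0 tv; have v0 : 0 < rho @@ v by exact: le_lt_trans tv.
exists ((rho @@ v - t) / (2 * rho @@ v)).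
  by rewrite divr_gt0 ?mulr_gt0// subr_gt0.
set b := _ / _ => tau rt u Au.
have /andP[_ tu] := rt u.1 u.2; have /andP[vt _] := rt v.1 v.2.
apply: lt_le_trans vt; apply: (le_lt_trans tu).
have b0 : 0 < b by rewrite divr_gt0 ?mulr_gt0// subr_gt0.
have bv : b * rho @@ v = (rho @@ v - t) / 2.
  by rewrite /b; move: (rho @@ v) v0 => w w0; rewrite invfM mulrA divfK ?gt_eqF.
have := At u Au => ut.
have h1 : b * rho @@ u <= b * t by rewrite ler_wpM2l// ltW.
have h2 : b * t < b * rho @@ v by rewrite ltr_pM2l.
lra.
Qed.

(** A difference between the suprema over [A] and [B] survives small stretches.
    If the suprema agree and are positive, a bump centred at a pair of [A] that
    nearly realises the supremum rises above the common value, while separation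
    keeps the bump below this value on [B]. *)
Lemma stably_dense_maxima_differ A B (N : R) :
  (forall u, A u -> d @@ u <= N) -> (forall v, B v -> d @@ v <= N) ->
  orbit_separated A B -> stably_dense G d (maxima_differ A B).
Proof.
move=> AN BN [eta eta0 AB] rho a rho_c a0.
have [rM rG [C C0 rC]] := rho_c.
have [[u0 Au0]|A0] := pselect (A !=set0); last first.
  exists rho, 1; split => //; first exact: (stretch_refl rM (ltW a0)).
  by move=> tau _ _ u v [Au _]; case: A0; exists u.
have [[v0 Bv0]|B0] := pselect (B !=set0); last first.
  exists rho, 1; split => //; first exact: (stretch_refl rM (ltW a0)).
  by move=> tau _ _ u v _ [Bv _]; case: B0; exists v.
have bd (E : set (X * X)) u : (forall u, E u -> d @@ u <= N) -> E u ->
    rho @@ u <= C * N.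
  move=> EN /EN uN; have /andP[_ h] := rC u.1 u.2; apply: le_trans h _.
  by rewrite ler_pM2l.
pose sA := isup A (fun u => rho @@ u); pose sB := isup B (fun u => rho @@ u).
have leA u : A u -> rho @@ u <= sA.
  by apply: (isup_ge (f := fun u => rho @@ u)) => j; exact: bd.
have leB u : B u -> rho @@ u <= sB.
  by apply: (isup_ge (f := fun u => rho @@ u)) => j; exact: bd.
have sA0 : 0 <= sA by apply: le_trans (leA _ Au0); exact: dist_ge0.
have sB0 : 0 <= sB by apply: le_trans (leB _ Bv0); exact: dist_ge0.
have [sAB|sBA|sAB] := ltgtP sA sB.
- have [v Bv sv] := isup_gt (ex_intro _ _ Bv0) sAB.
  have [b b0 H] := stretch_keeps_lt rM leA sA0 sv.
  exists rho, b; split => //; first exact: (stretch_refl rM (ltW a0)).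
  move=> tau _ rt u v' [Au _] [_ mv] _ E.
  by have := H tau rt u Au; rewrite E ltNge mv.
- have [u Au su] := isup_gt (ex_intro _ _ Au0) sBA.
  have [b b0 H] := stretch_keeps_lt rM leB sB0 su.
  exists rho, b; split => //; first exact: (stretch_refl rM (ltW a0)).
  move=> tau _ rt u' v [_ mu] [Bv _] _ E.
  by have := H tau rt v Bv; rewrite -E ltNge mu.
have [s0|s0] := leP sA 0.
  exists rho, 1; split => //; first exact: (stretch_refl rM (ltW a0)).
  move=> tau _ rt u v [Au _] _ tu; have /andP[_ h] := rt u.1 u.2.
  by have := leA u Au; lra.
have [|u Au su] := isup_gt (ex_intro _ _ Au0) (_ : sA / (1 + a) < sA).
  rewrite ltr_pdivrMr ?addr_gt0//; nra.
rewrite ltr_pdivrMr ?addr_gt0// in su.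
pose e := Num.min eta ((1 + a) * rho @@ u - sA).
have e0 : 0 < e by rewrite lt_min eta0; lra.
have e1 : e <= eta by rewrite ge_min lexx.
have e2 : e <= (1 + a) * rho @@ u - sA by rewrite ge_min lexx orbT.
pose s := orbit_bump G rho u.1 u.2 a (sA + e).
have su' : s @@ u = sA + e.
  apply: bump_center => //; last lra.
  by have := leA u Au; lra.
have sB' v : B v -> s @@ v <= sA.
  move=> Bv; apply: bump_le; last by rewrite sAB; exact: leB.
  suff : eta <= orbit_gap G rho u.1 u.2 v.1 v.2 by lra.
  apply: orbit_gap_ge => // g Gg; have [h [Gh gK _]] := group_inv Ggrp Gg.
  have [h1 h2] := AB u v h Au Bv Gh.
  have E x y : d (h y) x <= rho (g x) y.
    have /andP[+ _] := rC (g x) y.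
    by rewrite -(dG Gh (g x) y) gK (dist_sym dM x).
  by split; [have := E v.1 u.1; have := E v.2 u.2|
             have := E v.2 u.1; have := E v.1 u.2]; lra.
have sc : comparable_metric G d s by exact: bump_comparable.
have [sM _ _] := sc.
have [|b b0 H] := stretch_keeps_lt sM sB' (ltW s0) (v := u).
  by rewrite su'; lra.
exists s, b; split=> //; first exact: bump_stretch (ltW a0).
move=> tau _ rt u' v [_ mu] [Bv _] _ E.
by have := H tau rt v Bv; rewrite -E ltNge mu.
Qed.

(** Nearness is measured by [sigma] itself, so that the bijections preserving
    [sigma] preserve the notion. *)
Definition positive_local_max (sigma : X -> X -> R) x y :=
  0 < sigma x y /\ exists2 s, 0 < s & forall x' y',
    sigma x x' < s -> sigma y y' < s -> sigma x' y' <= sigma x y.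

Definition local_max_near p q r (sigma : X -> X -> R) := exists x y,
  [/\ d p x <= r, d q y <= r & positive_local_max sigma x y].

Lemma lip2_continuous (f : X * X -> R) C : 0 < C ->
  (forall u v, f v <= f u + C * (d u.1 v.1 + d u.2 v.2)) -> continuous f.
Proof.
move=> C0 fL u; apply/cvgrPdist_le => e e0.
have e' : 0 < e / (2 * C) by rewrite divr_gt0// mulr_gt0.
exists ([set x | d u.1 x < e / (2 * C)], [set x | d u.2 x < e / (2 * C)]).
  by split; exact: (near_dist dT).
move=> v [/= v1 v2].
have h : C * (d u.1 v.1 + d u.2 v.2) <= e.
  have E := divfK (lt0r_neq0 (mulr_gt0 (ltr0n R 2) C0)) e.
  set t := e / _ in E v1 v2; rewrite -E.
  have : C * (d u.1 v.1 + d u.2 v.2) <= C * (t + t).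
    by rewrite ler_pM2l// lerD// ltW.
  lra.
have := fL u v; have := fL v u.
rewrite (dist_sym dM v.1) (dist_sym dM v.2) ler_norml; lra.
Qed.

End Generic.

(** * Creating local maxima *)

Section LocalMax.
Context {R : realType} {X : topologicalType}.
Variables (G : set (X -> X)) (d : X -> X -> R).
Hypothesis Ggrp : homeomorphism_group G.
Hypothesis dC : Metr_c d.
Hypothesis dG : invariant_metric G d.

Let dM : is_metric d. Proof. by have [] := dC. Qed.
Let dT : induces_topology d. Proof. by have [] := dC. Qed.
Let dP : proper_metric d. Proof. by have [] := dC. Qed.

Lemma comparable_lip2 sigma : comparable_metric G d sigma ->
  exists2 C, 0 < C & forall u v : X * X,
    sigma v.1 v.2 <= sigma u.1 u.2 + C * (d u.1 v.1 + d u.2 v.2).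
Proof.
move=> [sM sG [C C0 sC]]; exists C => // u v.
have := dist_triangle sM v.1 u.1 v.2; have := dist_triangle sM u.1 u.2 v.2.
have /andP[_ h1] := sC u.1 v.1; have /andP[_ h2] := sC u.2 v.2.
rewrite (dist_sym sM v.1 u.1); lra.
Qed.

Lemma comparable_continuous sigma : comparable_metric G d sigma ->
  continuous (fun u : X * X => sigma u.1 u.2).
Proof. by move=> /comparable_lip2[C C0]; exact: (lip2_continuous dC C0). Qed.

(** After raising a bump at [{p, q}], the values at pairs whose gap is between
    [t / 2] and [t] are smaller than the value at [(p, q)], and they remain so
    under small stretches. A maximum over the compact set [A] of pairs near
    [(p, q)] is then a local maximum: among the pairs close to it, those of gap
    at least [t / 2] have smaller values, and the others are brought into [A] by
    an element of [G], up to a swap. *)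
Lemma stably_dense_local_max p q r : p <> q -> 0 < r ->
  stably_dense G d (local_max_near d p q r).
Proof.
move=> pq r0 rho a rho_c a0; have [rM rG [C C0 rC]] := rho_c.
have pq0 : 0 < rho p q by exact: dist_gt0.
pose t := Num.min (a * rho p q / 2) r.
have t0 : 0 < t by rewrite lt_min r0 divr_gt0 ?mulr_gt0.
have ta : t <= a * rho p q / 2 by rewrite ge_min lexx.
have tr : t <= r by rewrite ge_min lexx orbT.
pose c := rho p q + 2 * t; have c0 : 0 < c by rewrite /c; lra.
pose u := orbit_bump G rho p q a c.
have upq : u p q = c by apply: bump_center => //; rewrite /c; lra.
pose D := orbit_gap G rho p q.
have uD x y : t / 2 <= D x y -> D x y <= t -> u x y <= c - t / 2.
  move=> D1 D2; apply: bump_le; first by rewrite -/D; lra.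
  have := dist_le_orbit_gap Ggrp p q rM rG x y; rewrite -/D /c; lra.
pose b := t / 2 / c.
have b0 : 0 < b by rewrite !divr_gt0.
have bc : b * c = t / 2 by rewrite /b divfK// gt_eqF.
have uc : comparable_metric G d u by exact: bump_comparable.
exists u, b; split => //; first exact: bump_stretch (ltW a0).
move=> sigma sc us; have [sM sG _] := sc.
have su x y : u x y <= sigma x y by have /andP[] := us x y.
have ru x y : rho x y <= u x y.
  by have /andP[] := bump_stretch G p q rM c (ltW a0) x y.
have rs x y : rho x y <= sigma x y by exact: le_trans (ru x y) (su x y).
pose A : set (X * X) := [set z | rho z.1 p + rho z.2 q <= t / 2].
have Acl : closed A.
  have fc : continuous (fun z : X * X => rho z.1 p + rho z.2 q).
    apply: (@lip2_continuous _ _ _ dC _ C) => // z z'.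
    have := dist_triangle rM z'.1 z.1 p; have := dist_triangle rM z'.2 z.2 q.
    have /andP[_ h1] := rC z.1 z'.1; have /andP[_ h2] := rC z.2 z'.2.
    rewrite (dist_sym rM z'.1 z.1) (dist_sym rM z'.2 z.2); lra.
  exact: ((continuous_closedP _).1 fc _ (@closed_le R (t / 2))).
have Ac : compact A.
  apply: (@subclosed_compact _ A _ Acl (compact_setX (@dP p t) (@dP q t))).
  move=> z zt; have {}zt : rho z.1 p + rho z.2 q <= t / 2 := zt.
  have /andP[h1 _] := rC z.1 p; have /andP[h2 _] := rC z.2 q.
  have := dist_ge0 rM z.1 p; have := dist_ge0 rM z.2 q.
  by split; rewrite /closed_dball /= (dist_sym dM); lra.
have Apq : A (p, q) by rewrite /A /= !(dist_refl rM) addr0 divr_ge0// ltW.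
have [[x y] /set_mem Axy xymax] := compact_EVT_max (ex_intro _ _ Apq) Ac
   (continuous_subspaceT (comparable_continuous sc)).
have {xymax}xymax x' y' : A (x', y') -> sigma x' y' <= sigma x y.
  by move=> Az; apply: (xymax (x', y')); exact: mem_set.
have cxy : c <= sigma x y.
  by rewrite -upq; apply: le_trans (su p q) (xymax _ _ Apq).
have Dxy : D x y <= t / 2.
  have [h _] := orbit_gap_le p q rM x y (group_id Ggrp).
  exact: le_trans h Axy.
exists x, y; split.
- have /andP[h _] := rC x p; rewrite (dist_sym dM); apply: (le_trans h).
  by move: Axy; rewrite /A /=; have := dist_ge0 rM y q; lra.
- have /andP[h _] := rC y q; rewrite (dist_sym dM); apply: (le_trans h).
  by move: Axy; rewrite /A /=; have := dist_ge0 rM x p; lra.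
split; first exact: lt_le_trans cxy.
exists (t / 4) => [|x' y' xx' yy']; first by rewrite divr_gt0.
have D'xy : D x' y' <= t.
  have h1 := orbit_gap_lip Ggrp p q rM rG x' y' y.
  have h2 := orbit_gap_lip Ggrp p q rM rG y x' x.
  rewrite (orbit_gap_sym G rho p q x' y) (orbit_gap_sym G rho p q y x) in h1 h2.
  have := rs x x'; have := rs y y'; rewrite -/D in h1 h2 *; lra.
have [D'|D'] := leP (t / 2) (D x' y').
  have /andP[_ h] := us x' y'; apply: (le_trans h); apply: le_trans cxy.
  have := uD _ _ D' D'xy => h'.
  have : b * u x' y' <= b * c by rewrite ler_pM2l//; lra.
  lra.
have [f Gf [h|h]] := orbit_gap_lt Ggrp D'.
  by rewrite -(sG f Gf); apply: xymax; exact: ltW.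
rewrite -(sG f Gf) (dist_sym sM); apply: xymax.
by rewrite /A /= addrC; exact: ltW.
Qed.

End LocalMax.

(** * Metrics with a prescribed isometry group *)

(** Suppose that no element of [G] agrees with [g] at [y]. Then the pairs
    [{z, y}] are moved by a swap only, which makes [y] a fixed point of [G] and
    [g z] equal to [y] for every other [z]. By injectivity there is exactly one
    other point, and [G] is trivial. *)
Lemma offdiagonal_2hull (X : topologicalType) (G : set (X -> X)) (g : X -> X) :
  homeomorphism_group G -> ~ ((G #= `I_1)%card /\ ([set: X] #= `I_2)%card) ->
  injective g ->
  (forall x y, x <> y -> exists2 f, G f &
    (f x = g x /\ f y = g y) \/ (f x = g y /\ f y = g x)) ->
  symmetrized_2hull G g.
Proof.
move=> Ggrp card_GX ginj gP x y.
have [->{x}|/eqP xy] := eqVneq x y; last first.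
  have [f Gf fxy] := gP x y xy; exists f => //.
  by case: fxy => -[-> ->] //; rewrite setUC.
suff [f Gf fy] : exists2 f, G f & f y = g y by exists f => //; rewrite fy.
apply: contrapT => nf.
have nGy f : G f -> f y <> g y by move=> Gf fy; apply: nf; exists f.
have swap z : z <> y -> exists2 f, G f & f z = g y /\ f y = g z.
  by move=> /nesym yz; have [f Gf [[/nGy//]|[? ?]]] := gP y z yz; exists f.
have fixy f : G f -> f y = y.
  move=> Gf; apply: contrapT => /swap[h Gh [hfy _]].
  by apply: (nGy (h \o f)) => //; exact: group_comp.
have gz z : z <> y -> g z = y.
  by move=> /swap[f Gf [_ <-]]; exact: fixy.
have gyy : g y <> y.
  by apply/nesym; exact: (nGy _ (group_id Ggrp)).
have only z : z <> y -> z = g y.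
  by move=> zy; apply: ginj; rewrite gz// gz.
apply: card_GX; split.
  suff -> : G = [set idfun] by exact: card_set1.
  apply/seteqP; split=> [f Gf|_ ->]; last exact: group_id.
  apply/funext => z /=; have [->|/eqP zy] := eqVneq z y; first exact: fixy.
  rewrite [RHS](only z zy); apply: only => fzy; apply: zy.
  have [f' [_ fK _]] := group_inv Ggrp Gf.
  by rewrite -(fK z) fzy -{1}(fixy f Gf) fK.
apply/eq_cardSP; exists y => //.
suff -> : [set: X] `\ y = [set g y] by exact: card_set1.
by apply/seteqP; split=> [z [_ /= /only]//|_ ->]; split.
Qed.

Lemma comparable_Metr_c (R : realType) (X : topologicalType)
    (G : set (X -> X)) (d sigma : X -> X -> R) :
  Metr_c d -> comparable_metric G d sigma -> Metr_c sigma.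
Proof.
move=> [dM dT dP] [sM sG [C C0 sC]].
have sT : induces_topology sigma.
  apply: induces_topologyP => [x e e0|x A]; last first.
    move=> /(nbhs_distP dT)[e e0 eA].
    exists e => // y xy; apply: eA; apply: le_lt_trans xy.
    by have /andP[] := sC x y.
  have eC : 0 < e / C by rewrite divr_gt0.
  apply: filterS (near_dist dT x eC) => y /=; rewrite ltr_pdivlMr// => xy.
  by have /andP[_ h] := sC x y; apply: le_lt_trans h _; rewrite mulrC.
split => // x r.
apply: subclosed_compact (@dP x r) _; first exact: (closed_dball_closed sM sT).
by move=> y; apply: le_trans; have /andP[] := sC x y.
Qed.

Section RigidPerturbation.
Context {R : realType} {X : topologicalType}.
Variables (G : set (X -> X)) (d : X -> X -> R).
Hypothesis Ggrp : homeomorphism_group G.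
Hypothesis dC : Metr_c d.
Hypothesis dG : invariant_metric G d.

Let dM : is_metric d. Proof. by have [] := dC. Qed.
Let dT : induces_topology d. Proof. by have [] := dC. Qed.

Lemma stably_dense_implied (H : Prop) (P : (X -> X -> R) -> Prop) :
  (H -> stably_dense G d P) -> stably_dense G d (fun sigma => H -> P sigma).
Proof.
move=> HP rho a rho_c a0; have [h|nh] := pselect H.
  have [s [b [? ? ? H']]] := HP h rho a rho_c a0.
  by exists s, b; split => // tau tc st _; exact: H'.
have [rM _ _] := rho_c.
by exists rho, 1; split => //; exact: (stretch_refl rM (ltW a0)).
Qed.

Definition ball_product x y r : set (X * X) :=
  closed_dball d x r `*` closed_dball d y r.

(** Boxes centred at the terms of a sequence, with radii [1 / (n + 1)], keep the
    number of conditions countable. *)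
Definition generic (s : nat -> X) (sigma : X -> X -> R) :=
  (forall i j k l n, let r := n.+1%:R^-1 in
    let A := ball_product (s i) (s j) r in
    let B := ball_product (s k) (s l) r in
    orbit_separated G d A B -> maxima_differ A B sigma) /\
  (forall i j n, s i <> s j -> local_max_near d (s i) (s j) n.+1%:R^-1 sigma).

Lemma generic_exists s eps : 0 < eps -> exists sigma,
  [/\ comparable_metric G d sigma, stretch d eps sigma & generic s sigma].
Proof.
move=> eps0.
have d_c : comparable_metric G d d.
  by split => //; exists 1 => // x y; rewrite mul1r lexx.
pose P (i : (nat * nat * nat * nat * nat) + (nat * nat * nat)) sigma :=
  match i with
  | inl (i, j, k, l, n) => let r := n.+1%:R^-1 in
    let A := ball_product (s i) (s j) r in
    let B := ball_product (s k) (s l) r in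
    orbit_separated G d A B -> maxima_differ A B sigma
  | inr (i, j, n) => s i <> s j -> local_max_near d (s i) (s j) n.+1%:R^-1 sigma
  end.
have Pd i : stably_dense G d (P i).
  case: i => [[[[[i j] k] l] n]|[[i j] n]];
    apply: stably_dense_implied => H; last first.
    by apply: stably_dense_local_max => //; rewrite invr_gt0 ltr0n.
  set r := n.+1%:R^-1 in H *.
  have r0 : 0 < r by rewrite invr_gt0 ltr0n.
  have bd x y u : ball_product x y r u -> d u.1 u.2 <= 2 * r + d x y.
    move=> [/= h1 h2]; rewrite /closed_dball /= in h1 h2.
    have := dist_triangle dM u.1 x u.2; have := dist_triangle dM x y u.2.
    rewrite (dist_sym dM u.1 x); lra.
  apply: (@stably_dense_maxima_differ _ _ G d Ggrp dC dG _ _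
    (2 * r + d (s i) (s j) + d (s k) (s l))) => // u /bd.
    by have := dist_ge0 dM (s k) (s l); lra.
  by have := dist_ge0 dM (s i) (s j); lra.
have [sigma [sc ds sP]] := stably_dense_all Pd d_c eps0.
exists sigma; split => //; split=> [i j k l n|i j n].
  exact: (sP (inl (i, j, k, l, n))).
exact: (sP (inr (i, j, n))).
Qed.

(** Take a local maximum [(x, y)] near [(x0, y0)]. Small boxes around it and
    around its image under [g] have the same positive maximum, so they are not
    separated, and some [f] in [G] moves [{x, y}] almost as [g] does. *)
Lemma generic_isometry_near s sigma g x0 y0 e :
  (forall x r, 0 < r -> exists n, d x (s n) < r) ->
  comparable_metric G d sigma -> generic s sigma -> Iso sigma g ->
  x0 <> y0 -> 0 < e -> exists2 f, G f &
  (d (g x0) (f x0) < e /\ d (g y0) (f y0) < e) \/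
  (d (g x0) (f y0) < e /\ d (g y0) (f x0) < e).
Proof.
move=> sD sc [sI sII] [[g' gK g'K] gs] xy0 e0.
have [sM sG [C0 C00 sC0]] := sc.
have [C C1 sC] : exists2 C, 1 <= C &
    forall x y, d x y <= sigma x y <= C * d x y.
  exists (Num.max 1 C0) => [|x y]; first by rewrite le_max lexx.
  have /andP[-> h] := sC0 x y; apply: (le_trans h).
  by rewrite ler_wpM2r ?(dist_ge0 dM)// le_max lexx orbT.
have C_gt0 : 0 < C by exact: lt_le_trans C1.
have ds x y : d x y <= sigma x y by have /andP[] := sC x y.
have sd x y : sigma x y <= C * d x y by have /andP[] := sC x y.
have dxy0 := dist_gt0 dM xy0.
(* The errors made between [(x0, y0)], [(x, y)] and the boxes add up to less
   than [16 * C * t]; the second bound keeps the approximations of [x0] and [y0]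
   apart. *)
pose t := Num.min (e / (16 * C)) (d x0 y0 / 4).
have t0 : 0 < t by rewrite lt_min !divr_gt0// mulr_gt0.
have Cte : 16 * (C * t) <= e.
  have : t <= e / (16 * C) by rewrite ge_min lexx.
  by rewrite ler_pdivlMr ?mulr_gt0//; lra.
have tCt : t <= C * t by rewrite ler_peMl// ltW.
have txy : t <= d x0 y0 / 4 by rewrite ge_min lexx orbT.
have [n nt] := inv_nat_lt t0.
have n0 : 0 < n.+1%:R^-1 :> R by rewrite invr_gt0 ltr0n.
have [i xi] := sD x0 _ n0; have [j yj] := sD y0 _ n0.
have xit := lt_trans xi nt; have yjt := lt_trans yj nt.
have ij : s i <> s j.
  move=> E; have := dist_triangle dM x0 (s i) y0.
  by rewrite E (dist_sym dM (s j)) -{1}E; lra.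
have [x [y [ix jy [sxy0 [r r0 loc]]]]] := sII i j n ij.
have x0x : d x0 x <= 2 * t.
  have := dist_triangle dM x0 (s i) x; have := le_lt_trans ix nt; lra.
have y0y : d y0 y <= 2 * t.
  have := dist_triangle dM y0 (s j) y; have := le_lt_trans jy nt; lra.
have [m] : exists m, m.+1%:R^-1 < Num.min t (r / (4 * C)).
  by apply: inv_nat_lt; rewrite lt_min t0 divr_gt0// mulr_gt0.
set q := m.+1%:R^-1; rewrite lt_min => /andP[qt].
rewrite ltr_pdivlMr ?mulr_gt0// => qr.
have q0 : 0 < q by rewrite invr_gt0 ltr0n.
have [a1 xa1] := sD x _ q0; have [a2 ya2] := sD y _ q0.
have [b1 xb1] := sD (g x) _ q0; have [b2 yb2] := sD (g y) _ q0.
pose A := ball_product (s a1) (s a2) q; pose B := ball_product (s b1) (s b2) q.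
have near2 (z c v : X) : d z c < q -> d c v <= q -> d z v <= 2 * q.
  by move=> zc cv; have := dist_triangle dM z c v; lra.
have near_r z v : d z v <= 2 * q -> sigma z v < r.
  move=> zv; apply: le_lt_trans (sd z v) _.
  have : C * d z v <= C * (2 * q) by rewrite ler_pM2l.
  have : 0 < C * q by rewrite mulr_gt0.
  lra.
have Axy : A (x, y) by split; rewrite /closed_dball /= (dist_sym dM) ltW.
have Bxy : B (g x, g y) by split; rewrite /closed_dball /= (dist_sym dM) ltW.
have Amax : max_at A sigma (x, y).
  split=> // u [/= u1 u2].
  by apply: loc; apply: near_r; [exact: near2 xa1 u1|exact: near2 ya2 u2].
have Bmax : max_at B sigma (g x, g y).
  split=> // v [/= v1 v2]; rewrite gs -(g'K v.1) -(g'K v.2) gs.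
  by apply: loc; rewrite -gs g'K; apply: near_r;
    [exact: near2 xb1 v1|exact: near2 yb2 v2].
have [u [v [f [[/= Au1 Au2] [/= Bv1 Bv2] Gf uv]]]] :
    exists u v f, [/\ A u, B v, G f &
    d (f u.1) v.1 + d (f u.2) v.2 < q \/ d (f u.1) v.2 + d (f u.2) v.1 < q].
  apply: contrapT => no.
  have sep : orbit_separated G d A B.
    exists q => // u v f Au Bv Gf; split; rewrite leNgt; apply/negP => h;
      by apply: no; exists u, v, f; split => //; auto.
  by apply: (sI a1 a2 b1 b2 m sep _ _ Amax Bmax) => //=; rewrite gs.
have xu1 := near2 _ _ _ xa1 Au1; have yu2 := near2 _ _ _ ya2 Au2.
have gxv1 := near2 _ _ _ xb1 Bv1; have gyv2 := near2 _ _ _ yb2 Bv2.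
have move_pt z0 w0 z w u' v' : d z0 z <= 2 * t -> d w0 w <= 2 * t ->
    d w u' <= 2 * q -> d (g z) v' <= 2 * q -> d (f u') v' < q ->
    d (g z0) (f w0) < e.
  move=> z0z w0w wu gzv fuv.
  have gz0 : d (g z0) (g z) <= C * (2 * t).
    apply: le_trans (ds _ _) _; rewrite gs; apply: le_trans (sd _ _) _.
    by rewrite ler_pM2l.
  have fw0 : d (f w) (f w0) <= 2 * t by rewrite (dG Gf) (dist_sym dM).
  have fwu : d (f u') (f w) <= 2 * q by rewrite (dG Gf) (dist_sym dM).
  have := dist_triangle dM (g z0) (g z) (f w0).
  have := dist_triangle dM (g z) v' (f w0).
  have := dist_triangle dM v' (f u') (f w0).
  have := dist_triangle dM (f u') (f w) (f w0).
  by rewrite (dist_sym dM v' (f u')); lra.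
exists f => //; case: uv => h; [left|right];
  have := dist_ge0 dM (f u.1) v.1; have := dist_ge0 dM (f u.2) v.2;
  have := dist_ge0 dM (f u.1) v.2; have := dist_ge0 dM (f u.2) v.1;
  move=> h1 h2 h3 h4.
- by split; [apply: (move_pt _ _ x x u.1 v.1)|
             apply: (move_pt _ _ y y u.2 v.2)] => //; lra.
- by split; [apply: (move_pt _ _ x y u.2 v.1)|
             apply: (move_pt _ _ y x u.1 v.2)] => //; lra.
Qed.

(** Whether the approximating elements of [G] match [{x, y}] with its image
    directly or by a swap may depend on the precision, but one of the two
    alternatives occurs at all precisions, so [orbit_limit] applies to it. *)
Lemma rigid_perturbation eps :
  separable X -> closed_in_continuous_maps G -> symmetrized_2hull G = G ->
  ~ ((G #= `I_1)%card /\ ([set: X] #= `I_2)%card) -> 0 < eps ->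
  exists rho : X -> X -> R, [/\ Metr_c rho,
    (forall x y, d x y <= rho x y <= (1 + eps) * d x y) & Iso rho = G].
Proof.
move=> Xsep Gcl GH card_GX eps0.
have GIso rho : invariant_metric G rho -> G `<=` Iso rho.
  move=> rG g Gg; split; last exact: rG.
  by have [g' [_ gK g'K]] := group_inv Ggrp Gg; exists g'.
have [[x0 _]|X0] := pselect ([set: X] !=set0); last first.
  exists d; split => //; first exact: (stretch_refl dM (ltW eps0)).
  apply/seteqP; split; last exact: GIso.
  move=> g _; suff -> : g = idfun by exact: group_id.
  by apply/funext => x; case: X0; exists x.
have [s sD] := dense_sequence dT x0 Xsep.
have [sigma [sc ds sgen]] := generic_exists s eps0.
exists sigma; split => //; first exact: comparable_Metr_c sc.
have [sM sG _] := sc.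
apply/seteqP; split; last exact: GIso.
move=> g gI; have [_ gs] := gI; rewrite -GH; apply: offdiagonal_2hull => //.
  by move=> x y gxy; apply/(dist_eq0 sM); rewrite -gs gxy (dist_refl sM).
move=> x y xy; have near := generic_isometry_near sD sc sgen gI xy.
have [dir|] := pselect (forall e, 0 < e -> exists f,
    [/\ G f, d (g x) (f x) < e & d (g y) (f y) < e]).
  have [f [Gf fx fy]] := orbit_limit dC dG Ggrp Gcl dir.
  by exists f => //; left.
move=> /existsNP[e1 /not_implyP[e10 nodir]].
have [f [Gf fx fy]] : exists f, [/\ G f, f x = g y & f y = g x].
  apply: (orbit_limit dC dG Ggrp Gcl) => e e0.
  have [|f Gf] := near (Num.min e e1); first by rewrite lt_min e0.
  rewrite !lt_min => -[[/andP[_ h1] /andP[_ h2]]|[/andP[h1 _] /andP[h2 _]]].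
    by case: nodir; exists f.
  by exists f.
by exists f => //; right.
Qed.

End RigidPerturbation.

Theorem theorem1p7 (R : realType) (X : topologicalType) (G : set (X -> X))
    (X_polish : polish_space R X)
    (X_locally_compact : locally_compact [set: X])
    (G_group : homeomorphism_group G)
    (card_GX : ~ ((G #= `I_1)%card /\ ([set: X] #= `I_2)%card)) :
  [<-> (* (i) *)
       exists2 d : X -> X -> R, Metr_c d & Iso d = G;
       (* (ii) *)
       (exists2 d : X -> X -> R, Metr_c d & invariant_metric G d) /\
       (forall d : X -> X -> R, Metr_c d -> invariant_metric G d ->
        forall eps : R, 0 < eps ->
        exists rho : X -> X -> R,
          [/\ Metr_c rho,
              (forall x y, d x y <= rho x y <= (1 + eps) * d x y)
            & Iso rho = G]);
       (* (iii) *)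
       [/\ closed_in_continuous_maps G,
           (forall K : set X, compact K ->
              evenly_continuous (meeting_family G K) /\
              pointwise_precompact_family (meeting_family G K))
         & symmetrized_2hull G = G] ].
Proof.
have necessity (d : X -> X -> R) : Metr_c d -> Iso d = G ->
    [/\ closed_in_continuous_maps G,
       (forall K : set X, compact K ->
          evenly_continuous (meeting_family G K) /\
          pointwise_precompact_family (meeting_family G K))
     & symmetrized_2hull G = G].
  move=> dC <-.
  split; [exact: Iso_closed|move=> K Kc|exact: Iso_symmetrized_2hull].
  split; last exact: Iso_pointwise_precompact.
  by apply: (Iso_evenly_continuous dC) => f [].
have perturb (d : X -> X -> R) : closed_in_continuous_maps G ->
    symmetrized_2hull G = G -> Metr_c d -> invariant_metric G d ->
    forall eps : R, 0 < eps -> exists rho : X -> X -> R,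
      [/\ Metr_c rho, (forall x y, d x y <= rho x y <= (1 + eps) * d x y)
        & Iso rho = G].
  move=> Gcl GH dC dG eps eps0.
  by apply: rigid_perturbation => //; case: X_polish.
tfae.
- move=> [d dC dI]; have [Gcl _ GH] := necessity d dC dI.
  split; last by move=> d'; exact: perturb.
  by exists d => //; rewrite -dI => g [].
- move=> [[d dC dG] H]; have [rho [rC _ rI]] := H d dC dG 1 ltr01.
  exact: necessity rC rI.
- move=> [Gcl Gproper GH].
  have [d dC dG] := invariant_proper_metric_exists
    X_polish X_locally_compact G_group Gproper.
  have [rho [rC _ rI]] := perturb d Gcl GH dC dG 1 ltr01.
  by exists rho.
Qed.
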